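(* Suppose that there is a constant $\gamma>0$ such that $$\liminf_{t\to\infty}\int_t^{t+\gamma}a(s)\,ds>0 .$$ Then the equation $$dx(t)=x(t)\big[(r(t)-a(t)x(t))\,dt+\sigma(t)\,dB(t)\big]$$ is stochastically ultimately bounded.
   Context: Setting: $(\Omega,\mathcal F,P)$ is a complete probability space with a filtration $\{\mathcal F_t\}_{t\ge 0}$ satisfying the usual conditions, $B(t)$ is a standard one-dimensional Brownian motion on it, and $r,a,\sigma:[0,\infty)\to\mathbb R$ are (deterministic) continuous bounded functions with $a$ and $\sigma$ nonnegative. The equation is understood in the Itô sense. For any initial value $x_0\in R_+=(0,\infty)$ there is a unique solution $x(t)$ on $t\ge 0$ with $x(0)=x_0$, and it remains in $R_+$ with probability one; such solutions are called positive solutions. Definition: the equation is stochastically ultimately bounded if for any $\varepsilon\in(0,1)$ there exists a positive constant $M=M(\varepsilon)$ such that $\liminf_{t\to\infty}P\{x(t)\le M\}\ge 1-\varepsilon$ for any positive solution $x(t)$ ($M$ does not depend on the solution). *)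

(* Defs.v *)
From HB Require Import structures.
From mathcomp Require Import all_boot all_order all_algebra.
From mathcomp Require Import all_classical all_reals all_analysis.
Set Implicit Arguments.
Unset Strict Implicit.
Unset Printing Implicit Defensive.
Import Order.TTheory GRing.Theory Num.Theory.
Import numFieldNormedType.Exports.
Local Open Scope classical_set_scope.
Local Open Scope ring_scope.

(* Time is the half-line [0, +oo[ of R: a process is a function
   X : R -> Omega -> R of which only the values X t with 0 <= t are relevant. *)

Section filtered_probability_space.
Context {d : measure_display} {Omega : measurableType d} {R : realType}.
Variable P : probability Omega R.

Definition sub_measurable (G : set (set Omega)) (X : Omega -> R) : Prop :=
  forall U : set R, measurable U -> G (X @^-1` U).

Definition adapted (F : R -> set (set Omega)) (X : R -> Omega -> R) : Prop :=
  forall t : R, 0 <= t -> sub_measurable (F t) (X t).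

Definition ae_continuous (X : R -> Omega -> R) : Prop :=
  {ae P, forall w, {within `[0, +oo[, continuous (fun t => X t w)}}.

Record filtration (F : R -> set (set Omega)) : Prop := {
  filtration_sigma_algebra : forall t : R, 0 <= t -> sigma_algebra setT (F t);
  filtration_measurable : forall t : R, 0 <= t -> F t `<=` measurable;
  filtration_nondecreasing : forall s t : R, 0 <= s -> s <= t -> F s `<=` F t }.

Record usual_conditions (F : R -> set (set Omega)) : Prop := {
  usual_right_continuous : forall t : R, 0 <= t ->
    F t = \bigcap_(s in [set s | t < s]) F s;
  usual_null_sets : P.-negligible `<=` F 0 }.

(* [normal_prob m s] is parameterized by the standard deviation s. *)
Record brownian_motion (F : R -> set (set Omega)) (B : R -> Omega -> R)
    : Prop := {
  brownian_adapted : adapted F B;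
  brownian0 : {ae P, forall w, B 0 w = 0};
  brownian_continuous : ae_continuous B;
  brownian_independent : forall s t : R, 0 <= s -> s < t ->
    forall (A : set Omega) (U : set R), F s A -> measurable U ->
    P (A `&` (B t \- B s) @^-1` U) = (P A * P ((B t \- B s) @^-1` U)%R)%E;
  brownian_normal : forall s t : R, 0 <= s -> s < t ->
    forall U : set R, measurable U ->
    P ((B t \- B s) @^-1` U) = normal_prob 0 (Num.sqrt (t - s)) U }.

End filtered_probability_space.

Section ito_integral.
Context {d : measure_display} {Omega : measurableType d} {R : realType}.
Variables (P : probability Omega R) (F : R -> set (set Omega)).
Variable B : R -> Omega -> R.
Local Notation mu := (@lebesgue_measure R).

Record simple_process (T : R) := SimpleProcess {
  sp_size : nat;
  sp_time : nat -> R;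
  sp_val : nat -> Omega -> R;
  sp_time_first : sp_time 0%N = 0;
  sp_time_last : sp_time sp_size = T;
  sp_time_le : forall i, (i < sp_size)%N -> sp_time i <= sp_time i.+1;
  sp_val_measurable : forall i, (i < sp_size)%N ->
    sub_measurable (F (sp_time i)) (sp_val i);
  sp_val_bounded : exists C : R, forall i w, (i < sp_size)%N ->
    `|sp_val i w| <= C }.

Definition simple_fun (T : R) (f : simple_process T) (s : R) (w : Omega) : R :=
  \sum_(i < sp_size f)
    sp_val f i w * \1_(`]sp_time f i, sp_time f i.+1]) s.

Definition simple_integral (T : R) (f : simple_process T) (w : Omega) : R :=
  \sum_(i < sp_size f) sp_val f i w * (B (sp_time f i.+1) w - B (sp_time f i) w).

(* [ito_integral T phi I]: I is (a version of) the Ito integral of phi against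
   B over [0, T], i.e. the limit in probability of the elementary integrals of
   simple adapted processes phi_n such that the integral over [0, T] of
   |phi_n - phi|^2 tends to 0 in probability.  The integral is a relation since
   it is only determined up to almost sure equality. *)
Definition ito_integral (T : R) (phi : R -> Omega -> R) (I : Omega -> R)
    : Prop :=
  exists f : nat -> simple_process T,
    (forall e : R, 0 < e ->
      P [set w | (e%:E <= \int[mu]_(s in `[0%R, T])
                           ((simple_fun (f n) s w - phi s w) ^+ 2)%R%:E)%E]
        @[n --> \oo] --> 0%E) /\
    (forall e : R, 0 < e ->
      P [set w | e <= `|simple_integral (f n) w - I w|] @[n --> \oo] --> 0%E).

(* x is a strong solution on [0, +oo[ of dx = b(t, x) dt + g(t, x) dB. *)
Record sde_solution (b g : R -> R -> R) (x : R -> Omega -> R) : Prop := {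
  sde_adapted : adapted F x;
  sde_continuous : ae_continuous P x;
  sde_drift_integrable : {ae P, forall w, forall t : R, 0 <= t ->
    mu.-integrable `[0, t] (EFin \o (fun s => b s (x s w)))};
  sde_diffusion_integrable : {ae P, forall w, forall t : R, 0 <= t ->
    mu.-integrable `[0, t] (EFin \o (fun s => g s (x s w) ^+ 2))};
  sde_equation : forall t : R, 0 <= t -> exists I : Omega -> R,
    [/\ measurable_fun setT I,
        ito_integral t (fun s w => g s (x s w)) I &
        {ae P, forall w,
          x t w = x 0 w + \int[mu]_(s in `[0, t]) (b s (x s w)) + I w}] }.

Definition positive_solution (b g : R -> R -> R) (x : R -> Omega -> R) : Prop :=
  [/\ sde_solution b g x,
      exists2 x0 : R, 0 < x0 & {ae P, forall w, x 0 w = x0} &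
      {ae P, forall w, forall t : R, 0 <= t -> 0 < x t w}].

Definition stochastically_ultimately_bounded (b g : R -> R -> R) : Prop :=
  forall eps : R, 0 < eps -> eps < 1 -> exists2 M : R, 0 < M &
    forall x, positive_solution b g x ->
      ((1 - eps)%:E <=
        limf_einf (fun t : R => P [set w | (x t w <= M)%R]) (pinfty_nbhs R))%E.

End ito_integral.

(* Main.v *)
From HB Require Import structures.
Require Import Defs.
From mathcomp Require Import all_boot all_order all_algebra.
From mathcomp Require Import all_classical all_reals all_analysis.
From mathcomp Require Import measurable_realfun ring lra.
Import Order.TTheory GRing.Theory Num.Theory.
Import numFieldNormedType.Exports.
Local Open Scope classical_set_scope.
Local Open Scope ring_scope.

(* Fix N > 0 and let V(y) = N y / (N + y).  V is increasing, concave and bounded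
   by N, with y V'(y) <= V(y) and y^2 V'(y) = V(y)^2.  Since V is concave,
     V(x_T) - V(x_S) <= sum_i V'(x_{t_i}) (x_{t_{i+1}} - x_{t_i})
   along every partition of [S, T]: no Ito formula is needed.  The martingale part
   of the right-hand side is an Ito integral whose integrand V'(x_{t_i}) x sigma is
   asymptotically bounded, hence it has mean zero in the limit, so that
     E V(x_T) - E V(x_S) <= E int_S^T V'(x) x (r - a x) ds.
   With m(t) = E V(x_t) and Jensen's inequality this becomes
     m(T) - m(S) <= int_S^T (rb m - a m^2) ds,   rb = sup |r|.
   If m(t + gamma) exceeds a constant K depending only on rb, gamma and a lower
   bound of the integrals of a, then m(t) >= 2 m(t + gamma); as m <= N, eventually
   m <= K.  Markov's inequality then gives P(x_t > N) <= 2 K / N for all large t.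

   The only fact about the Ito integral that is used: if a simple process has
   energy int f^2 at most c on an event, then on that event its integral equals a
   random variable of mean zero and second moment at most 6 c, obtained by stopping
   the sum as soon as the energy exceeds c. *)

(** No moment of the solution is known in advance; this is why x is replaced by the bounded V(x),
    all of whose expectations exist. Boundedness of y V'(y) sigma helps only when V' and y are taken
    at the same time: along a partition the integrand V'(x_{t_i}) x_s sigma(s) need not be bounded,
    and its energy is controlled only in the limit of vanishing mesh, path by path. So its integral
    cannot be given mean zero directly, and the argument runs through events of large probability.
    The order of choice matters: first the weight lam of the second moment, then the probability rho
    of the bad event, small compared with lam, and only then the mesh. The halving of m is a
    Harnack-type argument: m at most doubles over a time 1 / (2 rb), so on a window of length gamma
    it is at most C times its initial value and at least its final value divided by C. If the final
    value is large, the quadratic loss exceeds the linear gain. Since K does not involve N, the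
    level N can be chosen last, as 2 K / eps; this makes the bound M common to all solutions. *)

Section integrable_EFin.
Context {d : measure_display} {T : measurableType d} {R : realType}.
Variables (mu : {measure set T -> \bar R}) (D : set T).
Hypothesis mD : measurable D.

Lemma integrable_EFinD (f g : T -> R) : mu.-integrable D (EFin \o f) ->
  mu.-integrable D (EFin \o g) -> mu.-integrable D (EFin \o (fun x => f x + g x)).
Proof.
move=> jf jg; rewrite (_ : _ \o _ = (EFin \o f) \+ (EFin \o g))//.
exact: integrableD.
Qed.

Lemma integrable_EFinZ (k : R) (f : T -> R) : mu.-integrable D (EFin \o f) ->
  mu.-integrable D (EFin \o (fun x => k * f x)).
Proof.
move=> jf; rewrite (_ : _ \o _ = (fun x => k%:E * (EFin \o f) x)%E)//.
exact: integrableZl.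
Qed.

End integrable_EFin.

Section integrability.
Context {d : measure_display} {T : measurableType d} {R : realType}.
Variable P : {finite_measure set T -> \bar R}.

Lemma bounded_integrable (f : T -> R) (C : R) (D : set T) : measurable D ->
  measurable_fun D f -> (forall x, D x -> `|f x| <= C) -> P.-integrable D (EFin \o f).
Proof.
move=> mD mf fC.
apply: (@le_integrable _ _ _ P _ mD _ (EFin \o cst C)).
- exact/measurable_EFinP.
- by move=> x Dx /=; rewrite lee_fin (le_trans (fC _ Dx))// ler_norm.
- by apply: (integrableS measurableT) => //; exact: finite_measure_integrable_cst.
Qed.

Lemma sqr_integrable (f : T -> R) : measurable_fun setT f ->
  P.-integrable setT (EFin \o (fun x => f x ^+ 2)) -> P.-integrable setT (EFin \o f).
Proof.
move=> mf if2.
apply: (@le_integrable _ _ _ P _ measurableT _ (EFin \o (fun w => 1 + f w ^+ 2))).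
- exact/measurable_EFinP.
- move=> w _ /=; rewrite lee_fin [leRHS]ger0_norm ?addr_ge0 ?sqr_ge0//.
  by rewrite ler_norml; apply/andP; split; nra.
- apply: integrable_EFinD => //; exact: finite_measure_integrable_cst.
Qed.

Lemma bounded_mul_integrable (f g : T -> R) (C : R) : measurable_fun setT g ->
  (forall x, `|g x| <= C) -> P.-integrable setT (EFin \o f) ->
  P.-integrable setT (EFin \o (f \* g)).
Proof.
move=> mg gC jf.
have mf : measurable_fun setT f by apply/measurable_EFinP; exact: measurable_int jf.
apply: (@le_integrable _ _ _ P _ measurableT _ (EFin \o (fun w => C * f w))).
- by apply/measurable_EFinP; exact: measurable_funM.
- move=> w _ /=; rewrite lee_fin !normrM mulrC ler_wpM2r//.
  by rewrite (le_trans (gC w))// ler_norm.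
- exact: integrable_EFinZ.
Qed.

End integrability.

(** * Independence and Gaussian increments *)

Section independence.
Context {d : measure_display} {Omega : measurableType d} {R : realType}.
Variable P : probability Omega R.

Definition independent (X Y : Omega -> R) :=
  forall U V : set R, measurable U -> measurable V ->
    P (X @^-1` U `&` Y @^-1` V) = (P (X @^-1` U) * P (Y @^-1` V))%E.

Variables X Y : Omega -> R.
Hypothesis (iX : P.-integrable setT (EFin \o X)).
Hypothesis (iY : P.-integrable setT (EFin \o Y)).
Hypothesis indep : independent X Y.

Let mX : measurable_fun setT X.
Proof. by apply/measurable_EFinP; exact: measurable_int iX. Qed.
Let mY : measurable_fun setT Y.
Proof. by apply/measurable_EFinP; exact: measurable_int iY. Qed.

HB.instance Definition _ := isMeasurableFun.Build _ _ _ _ X mX.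
HB.instance Definition _ := isMeasurableFun.Build _ _ _ _ Y mY.

Let PX : probability R R := distribution P (X : {mfun Omega >-> R}).
Let PY : probability R R := distribution P (Y : {mfun Omega >-> R}).
Let XY : Omega -> R * R := fun w => (X w, Y w).
Let mXY : measurable_fun setT XY.
Proof. exact: measurable_fun_pair. Qed.

HB.instance Definition _ := isMeasurableFun.Build _ _ _ _ XY mXY.

Let joint (A : set (R * R)) : measurable A ->
  (PX \x PY)%E A = pushforward P XY A.
Proof.
by move=> mA; exact: product_measure_unique.
Qed.

Let jointI (g : R * R -> \bar R) :
  (\int[PX \x PY]_z g z = \int[pushforward P XY]_z g z)%E.
Proof. by apply: eq_measure_integral => A mA _; exact: joint. Qed.

(** Independence says that the law of (X, Y) agrees with the product of the marginal laws on
    rectangles, hence everywhere. Tonelli applied to |x y| gives integrability, and Fubini then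
    gives the value. *)
Lemma independent_integrableM :
  P.-integrable setT (EFin \o (X \* Y)) /\
  (\int[P]_w (X w * Y w) = \int[P]_w X w * \int[P]_w Y w)%R.
Proof.
pose f (z : R * R) := (z.1 * z.2)%:E.
have mf : measurable_fun setT f.
  by apply/measurable_EFinP; apply: measurable_funM; [exact: measurable_fst|exact: measurable_snd].
have mnorm : measurable_fun [set: R] (fun y : R => `|y|%:E).
  by apply/measurable_EFinP; exact: normr_measurable.
have iP : P.-integrable setT (f \o XY).
  apply/integrableP; split.
    by apply: measurableT_comp.
  rewrite -(ge0_integral_pushforward mXY P measurableT (f := fun z => `|f z|%E))//; last first.
    exact: measurableT_comp.
  rewrite -jointI.
  rewrite fubini_tonelli1//; last exact: measurableT_comp.
  rewrite /fubini_F/=.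
  under eq_integral do under eq_integral do rewrite normrM EFinM.
  under eq_integral.
    move=> x _; rewrite ge0_integralZl//=.
    over.
  rewrite ge0_integralZr//=; last exact: integral_ge0.
  rewrite !ge0_integral_pushforward//=.
  rewrite lte_mul_pinfty//.
  - exact: integral_ge0.
  - by rewrite ge0_fin_numE ?integral_ge0//; case/integrableP : iX.
  - by case/integrableP : iY.
split; first exact: iP.
apply: EFin_inj; rewrite EFinM !fineK; last first.
all: try by exact: integrable_fin_num iX.
all: try by exact: integrable_fin_num iY.
all: try by exact: integrable_fin_num iP.
have iPXY : (PX \x PY)%E.-integrable setT f.
  apply/integrableP; split=> //.
  rewrite jointI.
  rewrite ge0_integral_pushforward//; last exact: measurableT_comp.
  by case/integrableP : iP.
transitivity (\int[pushforward P XY]_z f z)%E.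
  by rewrite integral_pushforward//.
rewrite -jointI.
rewrite -integral12_prod_meas1//= /fubini_F.
have iPX : PX.-integrable setT EFin.
  exact: integrable_pushforward.
have iPY : PY.-integrable setT EFin.
  exact: integrable_pushforward.
under eq_integral do under eq_integral do rewrite /f/= EFinM.
under eq_integral do rewrite integralZl//.
have YE : (\int[PY]_y y%:E = \int[P]_w (Y w)%:E)%E.
  by rewrite integral_pushforward.
rewrite YE.
have /fineK <- : (\int[P]_w (Y w)%:E)%E \is a fin_num.
  exact: integrable_fin_num iY.
rewrite integralZr//; congr (_ * _)%E.
by rewrite integral_pushforward.
Qed.

End independence.

Section density.
Local Open Scope ereal_scope.
Context {d : measure_display} {T : measurableType d} {R : realType}.
Variables (mu nu : {measure set T -> \bar R}) (g : T -> R).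
Hypotheses (mg : measurable_fun setT g) (g0 : forall x, (0 <= g x)%R).
Hypothesis nuE : forall U, measurable U -> nu U = \int[mu]_(x in U) (g x)%:E.

Import HBNNSimple.

Let nnsfun_density (f : {nnsfun T >-> R}) :
  \int[nu]_x (f x)%:E = \int[mu]_x ((f x)%:E * (g x)%:E).
Proof.
have mi r : measurable_fun setT (\1_(f @^-1` [set r]) : T -> R).
  by apply: measurable_indic; exact: measurable_sfunP.
under eq_integral do rewrite fimfunE -fsumEFin//.
rewrite ge0_integral_fsum//; last 2 first.
  - by move=> r; apply/measurable_EFinP/measurable_funM.
  - by move=> n x _; rewrite EFinM nnfun_muleindic_ge0.
under [RHS]eq_integral.
  move=> x xD; rewrite fimfunE -fsumEFin// muleC ge0_mule_fsumr; last first.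
    by move=> r; rewrite EFinM nnfun_muleindic_ge0.
  over.
rewrite [RHS]ge0_integral_fsum//; last 2 first.
  - move=> r; apply: emeasurable_funM; first exact/measurable_EFinP.
    by apply/measurable_EFinP; apply/measurable_funM.
  - by move=> n x _; rewrite mule_ge0 ?lee_fin// -lee_fin EFinM nnfun_muleindic_ge0.
apply: eq_fsbigr => r rf.
have r0 : (0 <= r)%R by move: rf; rewrite inE => -[x _ <-].
under eq_integral do rewrite EFinM.
rewrite ge0_integralZl//; last first.
  exact/measurable_EFinP.
under [RHS]eq_integral do rewrite EFinM muleCA.
rewrite ge0_integralZl//; last 2 first.
  - apply: emeasurable_funM; first exact/measurable_EFinP.
    exact/measurable_EFinP.
  - by move=> x _; rewrite mule_ge0 ?lee_fin.
have mA : measurable (f @^-1` [set r]) by exact: measurable_sfunP.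
rewrite (integral_indic nu measurableT mA) setIT nuE//; congr (_ * _).
rewrite integral_mkcond; apply: eq_integral => x _.
rewrite patchE indicE; case: ifPn => _; by rewrite ?mule1 ?mule0.
Qed.

(** Needed because the normal law is given by its values on sets; the formula passes from sets to
    simple functions and then to monotone limits. *)
Lemma integral_density (f : T -> \bar R) : measurable_fun setT f ->
  (forall x, 0 <= f x) -> \int[nu]_x f x = \int[mu]_x (f x * (g x)%:E).
Proof.
move=> mf f0.
pose f_ := nnsfun_approx measurableT mf.
transitivity (lim (\int[nu]_x (f_ n x)%:E @[n --> \oo])).
  rewrite -monotone_convergence//=.
  - apply: eq_integral => x /[!inE] xD; apply/esym/cvg_lim => //=.
    exact: cvg_nnsfun_approx.
  - by move=> n; exact/measurable_EFinP/measurable_funTS.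
  - by move=> n x _; rewrite lee_fin.
  - by move=> x _ a b mn; rewrite lee_fin; exact/lefP/nd_nnsfun_approx.
under eq_fun do rewrite nnsfun_density.
rewrite -monotone_convergence//=.
- apply: eq_integral => x /[!inE] xD; apply/cvg_lim => //=.
  apply: cvgeZr => //; exact: cvg_nnsfun_approx.
- move=> n; apply: emeasurable_funM; last exact/measurable_EFinP.
  exact/measurable_EFinP/measurable_funTS.
- by move=> n x _; rewrite mule_ge0 ?lee_fin.
- move=> x _ a b mn; rewrite lee_wpmul2r ?lee_fin//; exact/lefP/nd_nnsfun_approx.
Qed.

End density.

Section normal_moments.
Context {R : realType}.
Local Notation mu := (@lebesgue_measure R).

Lemma normal_pdf_opp (s x : R) : s != 0 -> normal_pdf 0 s (- x) = normal_pdf 0 s x.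
Proof. by move=> s0; rewrite !normal_pdfE// /normal_fun !subr0 sqrrN. Qed.

(* With [q = x^2 / 4 s^2] this is [q e^-q <= 1]. *)
Lemma sqr_normal_pdf_le (s x : R) : 0 < s ->
  x ^+ 2 * normal_pdf 0 s x <= 6 * s ^+ 2 * normal_pdf 0 (Num.sqrt 2 * s) x.
Proof.
move=> s0.
have sn0 : s != 0 by rewrite gt_eqF.
have sq2 : (0 : R) < Num.sqrt 2 by rewrite sqrtr_gt0.
have sq22 : (Num.sqrt 2) ^+ 2 = 2 :> R by rewrite sqr_sqrtr.
have s20 : Num.sqrt 2 * s != 0 by rewrite gt_eqF ?mulr_gt0.
rewrite !normal_pdfE// /normal_fun !subr0.
set q := x ^+ 2 / (4 * s ^+ 2).
have q0 : 0 <= q by rewrite divr_ge0 ?sqr_ge0// mulr_ge0 ?sqr_ge0.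
have -> : - x ^+ 2 / (s ^+ 2 *+ 2) = - q - q.
  by rewrite /q -mulr_natr; field.
have -> : - x ^+ 2 / ((Num.sqrt 2 * s) ^+ 2 *+ 2) = - q.
  by rewrite /q exprMn sq22 -mulr_natr; field.
have -> : normal_peak (Num.sqrt 2 * s) = normal_peak s / Num.sqrt 2.
  rewrite /normal_peak -invfM -sqrtrM; last first.
    by apply: mulrn_wge0; apply: mulr_ge0; [exact: sqr_ge0|exact: pi_ge0].
  rewrite exprMn sq22; have := pi_ge0 R; move: (pi) => p _.
  by rewrite (_ : 2 * s ^+ 2 * p *+ 2 = s ^+ 2 * p *+ 2 * 2)//; ring.
have -> : x ^+ 2 = 4 * s ^+ 2 * q by rewrite /q; field.
have p0 : 0 <= normal_peak s by exact: normal_peak_ge0.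
rewrite expRD.
have e0 : 0 < expR (- q) by exact: expR_gt0.
have qe : q * expR (- q) <= 1.
  by rewrite expRN ler_pdivrMr ?expR_gt0// mul1r; have := expR_ge1Dx q; lra.
(* The factor 4 comes from x^2 = 4 s^2 q and sqrt 2 from the ratio of the two peaks; rounding 4 sqrt
   2 up to 6 is the origin of the constant 6 in all later second moment bounds. *)
have h4 : 4 <= 6 / Num.sqrt 2 :> R.
  rewrite ler_pdivlMr//; nra.
set E := expR (- q) in e0 qe *.
have -> : 4 * s ^+ 2 * q * (normal_peak s * (E * E)) =
  (s ^+ 2 * normal_peak s * E) * (4 * (q * E)) by ring.
have -> : 6 * s ^+ 2 * (normal_peak s / Num.sqrt 2 * E) =
  (s ^+ 2 * normal_peak s * E) * (6 / Num.sqrt 2) by ring.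
apply: ler_wpM2l; first by rewrite !mulr_ge0// ?sqr_ge0 ?ltW.
lra.
Qed.

(** The exact value is s^2, but a constant factor is harmless. Comparison with the wider density of
    deviation sqrt 2 s, whose integral is 1, avoids an integration by parts. *)
Lemma normal_prob_second_moment (s : R) : 0 < s ->
  (\int[normal_prob 0 s]_x (x ^+ 2)%:E <= (6 * s ^+ 2)%:E)%E.
Proof.
move=> s0.
have msq : measurable_fun [set: R] (fun x : R => (x ^+ 2)%:E).
  by apply/measurable_EFinP; exact: measurable_funX.
rewrite (@integral_density _ _ _ mu (normal_prob 0 s) (normal_pdf 0 s)
  (measurable_normal_pdf 0 s) (normal_pdf_ge0 0 s) (fun U _ => erefl) _ msq); last first.
  by move=> x; rewrite lee_fin sqr_ge0.
apply: (@le_trans _ _ (\int[mu]_x ((6 * s ^+ 2)%:E * (normal_pdf 0 (Num.sqrt 2 * s) x)%:E))%E).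
  apply: ge0_le_integral => //.
  - by move=> x _; rewrite mule_ge0 ?lee_fin ?normal_pdf_ge0 ?sqr_ge0.
  - apply: emeasurable_funM; apply/measurable_EFinP => //.
      exact: measurable_normal_pdf.
  - apply: emeasurable_funM; apply/measurable_EFinP => //.
    exact: measurable_normal_pdf.
  - by move=> x _; rewrite -!EFinM lee_fin sqr_normal_pdf_le.
rewrite ge0_integralZl_EFin//.
- by rewrite integral_normal_pdf mule1.
- by move=> x _; rewrite lee_fin normal_pdf_ge0.
- by apply/measurable_EFinP; exact: measurable_normal_pdf.
- by rewrite mulr_ge0 ?sqr_ge0.
Qed.

Lemma normal_prob_opp (s : R) (U : set R) : s != 0 -> measurable U ->
  normal_prob 0 s (-%R @^-1` U) = normal_prob 0 s U.
Proof.
move=> s0 mU; rewrite /normal_prob.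
transitivity (\int[pushforward mu (-%R : R -> measurableTypeR R)]_(x in U)
    (normal_pdf 0 s x)%:E)%E.
  rewrite ge0_integral_pushforward//=.
  - by apply: eq_integral => x _ /=; rewrite normal_pdf_opp.
  - by apply/measurable_EFinP; apply: measurable_funTS; exact: measurable_normal_pdf.
  - by move=> x _; rewrite lee_fin normal_pdf_ge0.
by apply: eq_measure_integral => //= A mA _; exact: lebesgue_measureN.
Qed.

Context {d : measure_display} {Omega : measurableType d} (P : probability Omega R).

Lemma centered_normal_moments (Z : Omega -> R) (s : R) : 0 < s ->
  measurable_fun setT Z ->
  (forall U, measurable U -> P (Z @^-1` U) = normal_prob 0 s U) ->
  [/\ P.-integrable setT (EFin \o Z),
      P.-integrable setT (EFin \o (fun w => Z w ^+ 2)),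
      \int[P]_w Z w = 0 & \int[P]_w Z w ^+ 2 <= 6 * s ^+ 2].
Proof.
move=> s0 mZ hZ.
have sn0 : s != 0 by rewrite gt_eqF.
have msq : measurable_fun [set: R] (fun x : R => (x ^+ 2)%:E).
  by apply/measurable_EFinP; exact: measurable_funX.
have Z2 : (\int[P]_w (Z w ^+ 2)%:E <= (6 * s ^+ 2)%:E)%E.
  apply: le_trans (normal_prob_second_moment s s0).
  rewrite le_eqVlt; apply/orP; left; apply/eqP.
  transitivity (\int[pushforward P (Z : Omega -> measurableTypeR R)]_x (x ^+ 2)%:E)%E.
    by rewrite ge0_integral_pushforward// => x _; rewrite lee_fin sqr_ge0.
  by apply: eq_measure_integral => A mA _; exact: hZ.
have iZ2 : P.-integrable setT (EFin \o (fun w => Z w ^+ 2)).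
  apply/integrableP; split.
    by apply/measurable_EFinP; exact: measurable_funX.
  under eq_integral do rewrite /= ger0_norm ?sqr_ge0//.
  by apply: le_lt_trans Z2 _; rewrite ltry.
have iZ : P.-integrable setT (EFin \o Z) by exact: sqr_integrable.
split=> //.
(* The density is even, so Z and -Z have the same law and E Z = - E Z. *)
- pose NZ w : R := - Z w.
  have mNZ : measurable_fun setT NZ by exact: measurableT_comp.
  have : \int[P]_w Z w = \int[P]_w (- Z w).
    congr fine.
    transitivity (\int[pushforward P Z]_x x%:E)%E.
      by rewrite integral_pushforward//.
    transitivity (\int[pushforward P NZ]_x x%:E)%E; last first.
      rewrite integral_pushforward//.
      apply: (@eq_integrable _ _ _ P _ measurableT (\- (EFin \o Z))%E) => //.
      exact: integrableN.
    apply: eq_measure_integral => A mA _.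
    rewrite [LHS](_ : _ = P (Z @^-1` A))// [RHS](_ : _ = P (Z @^-1` (-%R @^-1` A)))//.
    have mNA : measurable (-%R @^-1` A : set R).
      by rewrite -[X in measurable X]setTI; exact: oppr_measurable.
    by rewrite (hZ A mA) (hZ _ mNA) normal_prob_opp.
  under [X in _ = X -> _]eq_Rintegral do rewrite -mulN1r.
  rewrite RintegralZl//; lra.
- rewrite -lee_fin fineK//; exact: integrable_fin_num iZ2.
Qed.

End normal_moments.

(** * Random variables measurable for a sub-sigma-algebra *)

Section sub_measurable.
Context {d : measure_display} {Omega : measurableType d} {R : realType}.
Variable G : set (set Omega).
Hypothesis sG : sigma_algebra setT G.

(** A sigma-algebra is the family of measurable sets of the type it generates, so the closure
    properties of [sub_measurable] are inherited from [measurable_fun]. *)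
Lemma sub_measurableP (X : Omega -> R) :
  sub_measurable G X <-> measurable_fun setT (X : g_sigma_algebraType G -> R).
Proof.
have GE : @measurable _ (g_sigma_algebraType G) = G by exact: sigma_algebra_id.
split=> [mX _ U mU|mX U mU].
  by rewrite setTI GE; exact: mX.
by have := mX measurableT U mU; rewrite setTI GE.
Qed.

Lemma sub_measurable_cst (c : R) : sub_measurable G (cst c).
Proof. by apply/sub_measurableP; exact: measurable_cst. Qed.

Lemma sub_measurableD (X Y : Omega -> R) : sub_measurable G X ->
  sub_measurable G Y -> sub_measurable G (X \+ Y).
Proof.
by move=> /sub_measurableP mX /sub_measurableP mY; apply/sub_measurableP; exact: measurable_funD.
Qed.

Lemma sub_measurableM (X Y : Omega -> R) : sub_measurable G X ->
  sub_measurable G Y -> sub_measurable G (X \* Y).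
Proof.
by move=> /sub_measurableP mX /sub_measurableP mY; apply/sub_measurableP; exact: measurable_funM.
Qed.

Lemma sub_measurable_comp (f : R -> R) (X : Omega -> R) :
  measurable_fun setT f -> sub_measurable G X -> sub_measurable G (f \o X).
Proof.
by move=> mf /sub_measurableP mX; apply/sub_measurableP; exact: measurableT_comp.
Qed.

Lemma sub_measurable_sum (I : eqType) (r : seq I) (Q : pred I) (X : I -> Omega -> R) :
  (forall i, i \in r -> Q i -> sub_measurable G (X i)) ->
  sub_measurable G (fun w => \sum_(i <- r | Q i) X i w).
Proof.
elim: r => [|i r IH] mX.
  under eq_fun do rewrite big_nil.
  exact: sub_measurable_cst.
under eq_fun do rewrite big_cons.
have IHr : sub_measurable G (fun w => \sum_(i <- r | Q i) X i w).
  by apply: IH => j jr; apply: mX; rewrite in_cons jr orbT.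
have [Qi|//] := boolP (Q i); apply: sub_measurableD => //; apply: mX => //.
by rewrite in_cons eqxx.
Qed.

End sub_measurable.

Section filtered.
Context {d : measure_display} {Omega : measurableType d} {R : realType}.
Variables (P : probability Omega R) (F : R -> set (set Omega)).
Hypothesis hF : filtration F.

Lemma sub_measurable_le (s t : R) (X : Omega -> R) : 0 <= s -> s <= t ->
  sub_measurable (F s) X -> sub_measurable (F t) X.
Proof.
by move=> s0 st mX U mU; apply: (filtration_nondecreasing hF s0 st); exact: mX.
Qed.

Lemma sub_measurable_fun (t : R) (X : Omega -> R) : 0 <= t ->
  sub_measurable (F t) X -> measurable_fun setT X.
Proof.
move=> t0 mX _ U mU; rewrite setTI; apply: (filtration_measurable hF t0); exact: mX.
Qed.

Variable B : R -> Omega -> R.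
Hypothesis hB : brownian_motion P F B.

Lemma brownian_increment_moments (s t : R) : 0 <= s -> s < t ->
  [/\ P.-integrable setT (EFin \o (B t \- B s)),
      P.-integrable setT (EFin \o (fun w => (B t w - B s w) ^+ 2)),
      \int[P]_w (B t w - B s w) = 0 &
      \int[P]_w (B t w - B s w) ^+ 2 <= 6 * (t - s)].
Proof.
move=> s0 st; have ts0 : 0 < t - s by rewrite subr_gt0.
have t0 : 0 <= t by rewrite ltW// (le_lt_trans s0).
have mBt : measurable_fun setT (B t).
  by apply: (@sub_measurable_fun t) => //; exact: brownian_adapted hB t t0.
have mBs : measurable_fun setT (B s).
  by apply: (@sub_measurable_fun s) => //; exact: brownian_adapted hB s s0.
have h : (0 : R) < Num.sqrt (t - s) by rewrite sqrtr_gt0.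
have := centered_normal_moments P (B t \- B s) _ h.
rewrite sqr_sqrtr; last exact: ltW.
apply; first exact: measurable_funB.
by move=> U mU; exact: (brownian_normal hB s0 st mU).
Qed.

Lemma brownian_increment_independent (s t : R) (X : Omega -> R) (f g : R -> R) :
  0 <= s -> s < t -> sub_measurable (F s) X ->
  measurable_fun setT f -> measurable_fun setT g ->
  independent P (f \o X) (fun w => g (B t w - B s w)).
Proof.
move=> s0 st mX mf mg U V mU mV.
have mfU : measurable (f @^-1` U) by rewrite -[X in measurable X]setTI; exact: mf.
have mgV : measurable (g @^-1` V) by rewrite -[X in measurable X]setTI; exact: mg.
exact: (brownian_independent hB s0 st (mX _ mfU) mgV).
Qed.

(* [Y] is an integral up to time [s] and [D] the coefficient of the next cell. *)
Lemma brownian_step_moments (s t C : R) (Y D : Omega -> R) :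
  0 <= s -> s <= t -> sub_measurable (F s) Y -> sub_measurable (F s) D ->
  (forall w, `|D w| <= C) ->
  P.-integrable setT (EFin \o (fun w => Y w ^+ 2)) ->
  \int[P]_w Y w = 0 ->
  let Z w := Y w + D w * (B t w - B s w) in
  [/\ sub_measurable (F t) Z, P.-integrable setT (EFin \o (fun w => Z w ^+ 2)),
      \int[P]_w Z w = 0 &
      \int[P]_w Z w ^+ 2 <= \int[P]_w Y w ^+ 2 + 6 * \int[P]_w (D w ^+ 2 * (t - s))].
Proof.
move=> s0 st mY mD DC iY2 EY Z.
have t0 : 0 <= t by rewrite (le_trans s0).
have sF (u : R) : 0 <= u -> sigma_algebra setT (F u) by exact: filtration_sigma_algebra.
have mBt (u : R) : 0 <= u -> sub_measurable (F u) (B u) by exact: (brownian_adapted hB).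
have mZF : sub_measurable (F t) Z.
  have mW : sub_measurable (F t) (fun w => B t w - B s w).
    apply: (@sub_measurableD _ _ _ _ (sF t t0) (B t) (fun w => - B s w)); first exact: mBt.
    apply: (@sub_measurable_comp _ _ _ _ (sF t t0) -%R); first exact: oppr_measurable.
    by apply: (sub_measurable_le s) => //; exact: mBt.
  apply: (@sub_measurableD _ _ _ _ (sF t t0)); first exact: (sub_measurable_le s).
  apply: (@sub_measurableM _ _ _ _ (sF t t0)) => //; exact: (sub_measurable_le s).
have mYT : measurable_fun setT Y by exact: (sub_measurable_fun s).
have mDT : measurable_fun setT D by exact: (sub_measurable_fun s).
have iY : P.-integrable setT (EFin \o Y) by exact: sqr_integrable.
have D2C w : `|D w ^+ 2| <= C ^+ 2.
  rewrite normrX lerXn2r// ?nnegrE//; exact: le_trans (DC w).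
have iD : P.-integrable setT (EFin \o D) by exact: (bounded_integrable P D C).
have iD2 : P.-integrable setT (EFin \o (fun w => D w ^+ 2)).
  by apply: (bounded_integrable P _ (C ^+ 2)) => //; exact: measurable_funX.
(* The Brownian increment laws are stated for s < t only; a degenerate cell, which does occur in the
   grids used below, adds nothing. *)
move: st; rewrite le_eqVlt => /predU1P[st|st].
  have ZE : Z = Y by apply/funext => w; rewrite /Z st subrr mulr0 addr0.
  split=> //; rewrite ZE// st subrr.
  by rewrite lerDl mulr_ge0// Rintegral_ge0// => w _; rewrite mulr0.
have [iW iW2 EW EW2] := brownian_increment_moments s t s0 st.
have mid : measurable_fun [set: R] (@id R) by exact: measurable_id.
have msq : measurable_fun [set: R] (fun x : R => x ^+ 2) by exact: measurable_funX.
have [iDW EDW] := independent_integrableM P D (B t \- B s) iD iW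
  (brownian_increment_independent s t D id id s0 st mD mid mid).
have [iD2W2 ED2W2] := independent_integrableM P (fun w => D w ^+ 2)
  (fun w => (B t w - B s w) ^+ 2) iD2 iW2
  (brownian_increment_independent s t D _ _ s0 st mD msq msq).
have mYD : sub_measurable (F s) (Y \* D) by exact: (@sub_measurableM _ _ _ _ (sF s s0)).
have iYD : P.-integrable setT (EFin \o (Y \* D)) by exact: (bounded_mul_integrable P Y D C).
have [iYDW EYDW] := independent_integrableM P (Y \* D) (B t \- B s) iYD iW
  (brownian_increment_independent s t (Y \* D) id id s0 st mYD mid mid).
(* In the expanded square the cross term has mean zero, because Y D is known at time s while the
   increment is independent of F s and centered. *)
have Z2E : (fun w => Z w ^+ 2) = (fun w => (Y w ^+ 2 +
    (2 * ((Y \* D) w * (B t \- B s) w) + D w ^+ 2 * (B t w - B s w) ^+ 2))).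
  by apply/funext => w; rewrite /Z/=; ring.
have iYDW2 : P.-integrable setT (EFin \o (fun w => 2 * ((Y \* D) w * (B t \- B s) w))).
  exact: integrable_EFinZ.
have iS : P.-integrable setT (EFin \o (fun w => 2 * ((Y \* D) w * (B t \- B s) w) +
    D w ^+ 2 * (B t w - B s w) ^+ 2)).
  exact: integrable_EFinD.
split=> //.
- by rewrite Z2E; exact: integrable_EFinD.
- rewrite /Z RintegralD// EY add0r.
  by rewrite EDW EW mulr0.
- rewrite Z2E RintegralD// lerD2l RintegralD// RintegralZl//.
  rewrite EYDW [\int[P]_w (B t \- B s) w]EW !mulr0 add0r ED2W2 RintegralZr//.
  rewrite mulrCA ler_wpM2l//.
  by apply: Rintegral_ge0 => w _; exact: sqr_ge0.
Qed.

End filtered.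

(** * Elementary integrals and truncation by energy *)

Section grid.
Context {R : realType}.

(** The grid is the sorted list of all points, with repetitions kept: it is only weakly increasing,
    and the lemmas below have to allow for cells of length zero. *)
Lemma grid_exists (S T : R) (pts : seq R) : S <= T ->
  (forall x, x \in pts -> S <= x <= T) ->
  exists (g : nat -> R) (n : nat),
    [/\ {homo g : i j / (i <= j)%N >-> i <= j}, g 0%N = S, g n = T &
        forall x, x \in pts -> exists2 p, (p <= n)%N & g p = x].
Proof.
move=> ST hpts; pose s := sort <=%O (S :: T :: pts).
have sin x : x \in s = (x \in S :: T :: pts) by rewrite mem_sort.
have sST x : x \in s -> S <= x <= T.
  rewrite sin !in_cons => /or3P[/eqP->|/eqP->|/hpts//]; by rewrite lexx ST.
have ss : sorted <=%O s by exact: (sort_sorted (@le_total _ R)).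
(* The default value T continues the grid as a constant, so that it is monotone on all of nat and
   takes the value T at index [size s]. *)
pose g i := nth T s i.
have gT i : g i <= T.
  have [ilt|ige] := ltnP i (size s); last by rewrite /g nth_default.
  by have /andP[] := sST _ (mem_nth T ilt).
have hg : {homo g : i j / (i <= j)%N >-> i <= j}.
  move=> i j ij; have [jlt|jge] := ltnP j (size s); last by rewrite [leRHS]/g nth_default.
  have := @sorted_leq_nth _ <=%R le_trans le_refl T s ss i j.
  by rewrite !inE (leq_ltn_trans ij jlt) jlt => /(_ isT isT ij).
have gin x : x \in s -> exists2 p, (p <= size s)%N & g p = x.
  by move=> xs; exists (index x s); [exact: index_size|rewrite /g nth_index].
exists g, (size s); split => //.
- have [p _ gp] : exists2 p, (p <= size s)%N & g p = S by apply: gin; rewrite sin mem_head.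
  apply/eqP; rewrite eq_le -{1}gp hg//=.
  have s0 : (0 < size s)%N by rewrite size_sort.
  by have /andP[] := sST _ (mem_nth T s0).
- by rewrite /g nth_default.
- by move=> x xp; apply: gin; rewrite sin !in_cons xp !orbT.
Qed.

Variable g : nat -> R.
Hypothesis hg : {homo g : i j / (i <= j)%N >-> i <= j}.

(** The indicator compares values of g rather than indices, as [grid_coef] does. The two conditions
    disagree only at repeated nodes, where the cell is degenerate and the increment of h
    vanishes. *)
Lemma grid_telescope (h : R -> R) (n p q : nat) : (p <= q)%N -> (q <= n)%N ->
  \sum_(i < n) ((g p <= g i) && (g i < g q))%:R * (h (g i.+1) - h (g i)) =
  h (g q) - h (g p).
Proof.
move=> pq qn.
rewrite -(big_mkord xpredT
  (fun i => ((g p <= g i) && (g i < g q))%:R * (h (g i.+1) - h (g i)))).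
rewrite (big_cat_nat (leq0n p) (leq_trans pq qn))/= (big_cat_nat pq qn)/=.
rewrite big_nat_cond big1 ?add0r; last first.
  move=> i /andP[/andP[_ ip] _]; have [gpi|_] := leP (g p) (g i); rewrite ?mul0r//=.
  rewrite (_ : g i.+1 = g i) ?subrr ?mulr0//.
  by apply/eqP; rewrite eq_le (hg i i.+1)// andbT (le_trans _ gpi)// hg.
rewrite [X in _ + X]big_nat_cond [X in _ + X]big1 ?addr0; last first.
  move=> i /andP[/andP[qi _] _].
  by have := hg _ _ qi; rewrite leNgt => /negbTE ->; rewrite andbF mul0r.
apply: (@telescope_sumr_eq _ _ _ (fun i => h (g i))) => // i /andP[pi iq].
rewrite hg//=; have [_|gqi] := ltP (g i) (g q); first by rewrite mul1r.
rewrite (_ : g i.+1 = g i) ?subrr ?mulr0//.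
by apply/eqP; rewrite eq_le (hg i i.+1)// andbT (le_trans _ gqi)// hg.
Qed.

(** No node lies strictly inside a cell, so a cell is either contained in ]g p, g q] or disjoint
    from it. *)
Lemma grid_cell (p q i : nat) (x : R) : g i < x <= g i.+1 ->
  (g p < x <= g q) = (g p <= g i) && (g i < g q).
Proof.
move=> /andP[ix xi]; congr andb.
- apply/idP/idP => [px|pi]; last exact: le_lt_trans ix.
  apply: hg; rewrite leqNgt; apply/negP => ip.
  by have := lt_le_trans px xi; rewrite ltNge hg.
- apply/idP/idP => [xq|iq]; first exact: lt_le_trans xq.
  rewrite (le_trans xi)// hg// ltnNge; apply/negP => qi.
  by move: iq; rewrite ltNge hg.
Qed.

End grid.

Section blocks.
Context {d : measure_display} {Omega : measurableType d} {R : realType}.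
Variables (P : probability Omega R) (F : R -> set (set Omega)).
Hypothesis hF : filtration F.
Variable B : R -> Omega -> R.
Hypothesis hB : brownian_motion P F B.
Local Notation mu := (@lebesgue_measure R).
Local Notation block := (R * R * (Omega -> R))%type.

(* A block [(s, t, c)] stands for the process [c * 1_]s, t]]. *)
Definition adapted_block (S T : R) (b : block) :=
  [/\ S <= b.1.1, b.1.1 <= b.1.2, b.1.2 <= T, sub_measurable (F b.1.1) b.2 &
      exists C : R, forall w, `|b.2 w| <= C].

(** The intervals may overlap and come in any order. Sums of processes are then concatenations of
    lists, and a common subdivision is taken only once, for the truncation. *)
Definition adapted_blocks (S T : R) (L : seq block) :=
  forall b, b \in L -> adapted_block S T b.

Definition blocks_fun (L : seq block) (s : R) (w : Omega) : R :=
  \sum_(b <- L) b.2 w * \1_(`]b.1.1, b.1.2]) s.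

Definition blocks_int (L : seq block) (w : Omega) : R :=
  \sum_(b <- L) b.2 w * (B b.1.2 w - B b.1.1 w).

Lemma measurable_blocks_fun L w : measurable_fun setT (fun x => blocks_fun L x w).
Proof.
by apply: measurable_sum => b; apply: measurable_funM.
Qed.

Section on_a_grid.
Variables (S T : R) (L : seq block).
Hypotheses (S0 : 0 <= S) (hL : adapted_blocks S T L).
Variables (g : nat -> R) (n : nat).
Hypotheses (hg : {homo g : i j / (i <= j)%N >-> i <= j}) (g0 : g 0%N = S) (gn : g n = T).
Hypothesis gL : forall b, b \in L ->
  (exists2 p, (p <= n)%N & g p = b.1.1) /\ (exists2 p, (p <= n)%N & g p = b.1.2).

(** The constant value of the block process on ]g i, g i.+1]. Only blocks already started at g i
    contribute, so it is known at time g i. *)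
Definition grid_coef (i : nat) (w : Omega) : R :=
  \sum_(b <- L | (b.1.1 <= g i) && (g i < b.1.2)) b.2 w.

Lemma grid_blocks_int w :
  blocks_int L w = \sum_(i < n) grid_coef i w * (B (g i.+1) w - B (g i) w).
Proof.
rewrite /blocks_int /grid_coef; under [RHS]eq_bigr do rewrite mulr_suml big_mkcond.
rewrite exchange_big; apply: eq_big_seq => b bL.
have [[p pn gp] [q qn gq]] := gL b bL; have [_ lehi _ _ _] := hL b bL.
rewrite -gp -gq in lehi *.
have [pq|qp] := leqP p q.
  rewrite -(grid_telescope g hg (fun t => B t w) n p q pq qn) mulr_sumr.
  by apply: eq_bigr => i _; case: ifP; rewrite ?mul1r ?mul0r ?mulr0.
(* Indices in the wrong order can only represent a block of length zero, for which both sides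
   vanish. *)
have gpq : g p = g q by apply/eqP; rewrite eq_le lehi hg// ltnW.
rewrite gpq subrr mulr0 big1// => i _; case: ifP => // /andP[h1 h2].
by move: (le_lt_trans h1 h2); rewrite ltxx.
Qed.

Lemma grid_blocks_fun i x w : g i < x <= g i.+1 -> blocks_fun L x w = grid_coef i w.
Proof.
move=> ix; rewrite /blocks_fun /grid_coef [RHS]big_mkcond; apply: eq_big_seq => b bL.
have [[p pn gp] [q qn gq]] := gL b bL.
rewrite indicE -gp -gq -(grid_cell g hg p q i x ix) mem_setE in_itv/=.
by case: ifP; rewrite ?mulr1 ?mulr0.
Qed.

Lemma grid_int_sqr w : (\int[mu]_(x in `]S, T]) (blocks_fun L x w ^+ 2)%:E =
  (\sum_(i < n) grid_coef i w ^+ 2 * (g i.+1 - g i))%:E)%E.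
Proof.
rewrite -gn -g0; elim: (n) => [|k IH].
  by rewrite big_ord0 set_itvoc0 integral_set0.
rewrite big_ord_recr EFinD/= -IH.
have -> : `]g 0%N, g k.+1]%classic = `]g 0%N, g k] `|` `]g k, g k.+1].
  by rewrite -itv_bndbnd_setU// bnd_simp hg.
have mf : measurable_fun setT (fun x => (blocks_fun L x w ^+ 2)%:E).
  by apply/measurable_EFinP; apply: measurable_funX; exact: measurable_blocks_fun.
rewrite ge0_integral_setU//=; last 3 first.
- exact: measurable_funTS.
- by move=> x _; rewrite lee_fin sqr_ge0.
- apply/disj_setPS => x [] /=; rewrite !in_itv/= => /andP[_ h1] /andP[h2 _].
  by move: (le_lt_trans h1 h2); rewrite ltxx.
congr (_ + _)%E.
under eq_integral.
  move=> x; rewrite inE/= in_itv/= => /grid_blocks_fun ->.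
  over.
rewrite integral_cst//= lebesgue_measure_itv/= lte_fin.
case: ltP => [_|h]; first by rewrite -EFinB -EFinM.
by rewrite (_ : g k.+1 = g k) ?subrr ?mulr0 ?mule0//; apply/eqP; rewrite eq_le h hg.
Qed.

Lemma sub_measurable_grid_coef i : sub_measurable (F (g i)) (grid_coef i).
Proof.
have gi0 : 0 <= g i by rewrite (le_trans S0)// -g0 hg.
apply: sub_measurable_sum; first exact: (filtration_sigma_algebra hF).
move=> b bL /andP[bi _]; have [Sb _ _ mb _] := hL b bL.
by apply: (sub_measurable_le F hF b.1.1) => //; exact: le_trans Sb.
Qed.

Lemma grid_coef_bounded i : exists C : R, forall w, `|grid_coef i w| <= C.
Proof.
rewrite /grid_coef.
have : forall b, b \in L -> exists C : R, forall w, `|b.2 w| <= C.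
  by move=> b bL; have [] := hL b bL.
elim: (L) => [|b l IH] hb; first by exists 0 => w; rewrite big_nil normr0.
have [C hC] := IH (fun b' h => hb b' (@mem_behead _ (b :: l) _ h)).
have [C' hC'] := hb b (mem_head _ _).
exists (C' + C) => w; rewrite big_cons; case: ifP => _.
  by rewrite (le_trans (ler_normD _ _))// lerD.
by rewrite (le_trans (hC w))// lerDr (le_trans _ (hC' w)).
Qed.

Variable N : R.
Hypothesis N0 : 0 <= N.

Let energy (k : nat) (w : Omega) : R :=
  \sum_(i < k) grid_coef i w ^+ 2 * (g i.+1 - g i).

(** The indicator tests the energy including cell i itself. This is still known at time g i, since
    it involves the coefficients 0, ..., i only; the sum thus stops before the level N is exceeded,
    without overshoot. *)
Let D (i : nat) (w : Omega) : R :=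
  grid_coef i w * \1_(`]-oo, N]) (energy i.+1 w).

Let Y (k : nat) (w : Omega) : R :=
  \sum_(i < k) D i w * (B (g i.+1) w - B (g i) w).

Let Q (k : nat) (w : Omega) : R := \sum_(i < k) D i w ^+ 2 * (g i.+1 - g i).

Let dg i : 0 <= g i.+1 - g i. Proof. by rewrite subr_ge0 hg. Qed.


Let energy_le k l w : (k <= l)%N -> energy k w <= energy l w.
Proof.
move=> kl; rewrite -(subnKC kl) /energy big_split_ord/= lerDl sumr_ge0// => i _.
by rewrite mulr_ge0 ?sqr_ge0.
Qed.

Let sub_measurable_energy k t : 0 <= t -> (forall i, (i < k)%N -> g i <= t) ->
  sub_measurable (F t) (energy k).
Proof.
move=> t0 kt; have sF := filtration_sigma_algebra hF t0.
apply: (sub_measurable_sum _ sF) => -[i ik] _ _ /=.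
have gi0 : 0 <= g i by rewrite (le_trans S0)// -g0 hg.
have m1 : sub_measurable (F t) (grid_coef i).
  apply: (sub_measurable_le F hF (g i)) => //; first exact: kt.
  exact: sub_measurable_grid_coef.
apply: (sub_measurable_comp _ sF (fun x => x ^+ 2 * (g i.+1 - g i))) => //.
by apply: measurable_funM => //; exact: measurable_funX.
Qed.

Let sub_measurable_D i : sub_measurable (F (g i)) (D i).
Proof.
have gi0 : 0 <= g i by rewrite (le_trans S0)// -g0 hg.
have sF := filtration_sigma_algebra hF gi0.
apply: (sub_measurableM _ sF); first exact: sub_measurable_grid_coef.
apply: (sub_measurable_comp _ sF (\1_(`]-oo, N])) (energy i.+1)).
  by apply: measurable_indic; exact: measurable_itv.
by apply: sub_measurable_energy => // j ji; rewrite hg.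
Qed.

Let D_bounded i : exists C : R, forall w, `|D i w| <= C.
Proof.
have [C hC] := grid_coef_bounded i; exists C => w.
rewrite /D normrM (le_trans _ (hC w))// ler_piMr// indicE.
by case: (_ \in _); rewrite ?normr1 ?normr0.
Qed.

(** The induction carries Q <= energy as well: while the energy is at most N this bounds Q, and once
    it exceeds N no further term is added. *)
Let Q_le k w : Q k w <= N.
Proof.
suff : Q k w <= energy k w /\ Q k w <= N by case.
elim: k => [|k [IH1 IH2]]; first by rewrite /Q /energy !big_ord0.
have QS : Q k.+1 w = Q k w + D k w ^+ 2 * (g k.+1 - g k) by rewrite /Q big_ord_recr.
have eS : energy k.+1 w = energy k w + grid_coef k w ^+ 2 * (g k.+1 - g k).
  by rewrite /energy big_ord_recr.
have h : Q k.+1 w <= energy k.+1 w.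
  rewrite QS eS; apply: lerD => //; apply: ler_wpM2r => //.
  rewrite /D exprMn; apply: ler_piMr; first exact: sqr_ge0.
  by rewrite indicE exprn_ile1// lern1 leq_b1.
split=> //; have [eN|eN] := leP (energy k.+1 w) N; first exact: le_trans eN.
by rewrite QS /D indicE mem_setE in_itv/= [energy _ _ <= N]leNgt eN mulr0 expr0n mul0r addr0.
Qed.

Let Q_integrable k : P.-integrable setT (EFin \o Q k).
Proof.
apply: (bounded_integrable P _ N) => //; last first.
  move=> w _; rewrite ger0_norm ?Q_le//.
  by apply: sumr_ge0 => i _; rewrite mulr_ge0 ?sqr_ge0.
rewrite /Q; apply: measurable_sum => i; apply: measurable_funM => //.
apply: measurable_funX; apply: (sub_measurable_fun F hF (g i)) => //.
by rewrite (le_trans S0)// -g0 hg.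
Qed.

Let Y_moments k :
  [/\ sub_measurable (F (g k)) (Y k), P.-integrable setT (EFin \o (fun w => Y k w ^+ 2)),
      \int[P]_w Y k w = 0 & \int[P]_w Y k w ^+ 2 <= 6 * \int[P]_w Q k w].
Proof.
elim: k => [|k [IH1 IH2 IH3 IH4]].
  have Y0 : Y 0%N = cst 0 by apply/funext => w; rewrite /Y big_ord0.
  rewrite Y0 /=; split.
  - by apply: sub_measurable_cst; apply: (filtration_sigma_algebra hF); rewrite g0.
  - rewrite (_ : _ \o _ = cst 0%E); first exact: integrable0.
    by apply/funext => w /=; rewrite expr0n.
  - by rewrite Rintegral_cst// mul0r.
  - under eq_Rintegral do rewrite expr0n.
    rewrite Rintegral_cst// mul0r mulr_ge0// Rintegral_ge0// => w _.
    by rewrite /Q big_ord0.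
have [C hC] := D_bounded k.
have gk0 : 0 <= g k by rewrite (le_trans S0)// -g0 hg.
have := brownian_step_moments P F hF B hB (g k) (g k.+1) C (Y k) (D k) gk0 (hg k k.+1 (leqnSn _))
  IH1 (sub_measurable_D k) hC IH2 IH3.
rewrite (_ : (fun w => _) = Y k.+1); last first.
  by apply/funext => w; rewrite /Y big_ord_recr.
move=> [h1 h2 h3 h4]; split => //; apply: (le_trans h4).
have -> : \int[P]_w Q k.+1 w = \int[P]_w Q k w + \int[P]_w (D k w ^+ 2 * (g k.+1 - g k)).
  under eq_Rintegral do rewrite /Q big_ord_recr/=.
  rewrite RintegralD//; first exact: Q_integrable.
  apply: (bounded_integrable P _ (C ^+ 2 * (g k.+1 - g k))) => //.
    apply: measurable_funM => //; apply: measurable_funX.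
    exact: (sub_measurable_fun F hF (g k)).
  move=> w _; rewrite ger0_norm; last by rewrite mulr_ge0 ?sqr_ge0.
  apply: ler_wpM2r => //; rewrite -real_normK ?num_real//.
  by rewrite lerXn2r ?nnegrE//; exact: le_trans (hC w).
by rewrite mulrDr lerD2r.
Qed.

Lemma grid_truncated_int : exists Y : Omega -> R,
  [/\ measurable_fun setT Y, P.-integrable setT (EFin \o (fun w => Y w ^+ 2)),
      \int[P]_w Y w = 0, \int[P]_w Y w ^+ 2 <= 6 * N &
      forall w, (\int[mu]_(x in `]S, T]) (blocks_fun L x w ^+ 2)%:E <= N%:E)%E ->
        Y w = blocks_int L w].
Proof.
have [h1 h2 h3 h4] := Y_moments n.
have gn0 : 0 <= g n by rewrite (le_trans S0)// -g0 hg.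
exists (Y n); split => //; first exact: (sub_measurable_fun F hF (g n)).
- apply: (le_trans h4); rewrite ler_wpM2l//.
  have -> : N = \int[P]_w (cst N) w.
    by rewrite Rintegral_cst//= probability_setT/= mulr1.
  by apply: le_Rintegral => //; exact: finite_measure_integrable_cst.
- move=> w; rewrite grid_int_sqr lee_fin => eN.
  rewrite grid_blocks_int /Y; apply: eq_bigr => i _; congr (_ * _).
  (* The energy increases with the index, so if the total is at most N no coefficient was cut. *)
  rewrite /D indicE mem_setE in_itv/= (le_trans _ eN) ?mulr1//.
  exact: energy_le.
Qed.

End on_a_grid.

Lemma truncated_blocks_int (S T : R) (L : seq block) (N : R) :
  0 <= S -> S <= T -> adapted_blocks S T L -> 0 <= N ->
  exists Y : Omega -> R,
  [/\ measurable_fun setT Y, P.-integrable setT (EFin \o (fun w => Y w ^+ 2)),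
      \int[P]_w Y w = 0, \int[P]_w Y w ^+ 2 <= 6 * N &
      forall w, (\int[mu]_(x in `]S, T]) (blocks_fun L x w ^+ 2)%:E <= N%:E)%E ->
        Y w = blocks_int L w].
Proof.
move=> S0 ST hL N0.
have [] := grid_exists S T ([seq b.1.1 | b <- L] ++ [seq b.1.2 | b <- L]) ST.
  move=> x; rewrite mem_cat => /orP[] /mapP[b bL ->].
  - by have [h1 h2 h3 _ _] := hL b bL; rewrite h1 (le_trans h2).
  - by have [h1 h2 h3 _ _] := hL b bL; rewrite h3 (le_trans h1).
move=> g [n [hg g0 gn gL]].
apply: (grid_truncated_int S T L S0 hL g n) => // b bL.
by split; apply: gL; rewrite mem_cat; apply/orP; [left|right]; apply/mapP; exists b.
Qed.

End blocks.

Lemma int_sqr_le {d : measure_display} {T : measurableType d} {R : realType}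
    (mu : {measure set T -> \bar R}) (D : set T) (f g h : T -> R) (a b : R) :
  measurable D -> measurable_fun D f -> measurable_fun D g ->
  (forall x, D x -> h x = f x + g x) ->
  (\int[mu]_(x in D) (f x ^+ 2)%:E <= a%:E)%E ->
  (\int[mu]_(x in D) (g x ^+ 2)%:E <= b%:E)%E ->
  (\int[mu]_(x in D) (h x ^+ 2)%:E <= (2 * (a + b))%:E)%E.
Proof.
move=> mD mf mg hE fa gb.
have mf2 : measurable_fun D (fun x => (f x ^+ 2)%:E).
  by apply/measurable_EFinP; exact: measurable_funX.
have mg2 : measurable_fun D (fun x => (g x ^+ 2)%:E).
  by apply/measurable_EFinP; exact: measurable_funX.
have s0 (k : T -> R) x : D x -> (0 <= (k x ^+ 2)%:E)%E by rewrite lee_fin sqr_ge0.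
apply: (@le_trans _ _ (\int[mu]_(x in D) (2%:E * ((f x ^+ 2)%:E + (g x ^+ 2)%:E)))%E).
  apply: ge0_le_integral => //.
  - exact: s0.
  - apply/measurable_EFinP; apply: measurable_funX.
    by apply: (eq_measurable_fun (f \+ g)) => [x /[!inE] /hE ->//|]; exact: measurable_funD.
  - by apply: measurable_funeM; exact: emeasurable_funD.
  - by move=> x Dx; rewrite -EFinD -EFinM lee_fin hE//; have := sqr_ge0 (f x - g x); nra.
rewrite ge0_integralZl_EFin//.
- by rewrite ge0_integralD ?EFinM ?EFinD//; [rewrite lee_wpmul2l ?lee_fin ?leeD|exact: s0|exact: s0].
- by move=> x Dx; rewrite adde_ge0 ?s0.
- exact: emeasurable_funD.
Qed.

Lemma probability_setCI_le {d : measure_display} {T : measurableType d} {R : realType}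
    (P : probability T R) (G1 G2 : set T) (a b : R) :
  measurable G1 -> measurable G2 ->
  (P (~` G1) <= a%:E)%E -> (P (~` G2) <= b%:E)%E -> (P (~` (G1 `&` G2)) <= (a + b)%:E)%E.
Proof.
move=> m1 m2 h1 h2; rewrite setCI EFinD.
apply: le_trans (leeD h1 h2).
by apply: measureU2; exact: measurableC.
Qed.

Lemma sqr_markov {d : measure_display} {T : measurableType d} {R : realType}
    (P : probability T R) (Y : T -> R) (e a : R) : 0 < e ->
  measurable_fun setT Y -> P.-integrable setT (EFin \o (fun w => Y w ^+ 2)) ->
  \int[P]_w Y w ^+ 2 <= a ->
  measurable [set w | `|Y w| <= e] /\ (P (~` [set w | (`|Y w| <= e)%R]) <= (a / e ^+ 2)%:E)%E.
Proof.
move=> e0 mY iY2 Ya.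
have mG : measurable [set w | `|Y w| <= e].
  rewrite (_ : [set _ | _] = setT `&` (fun w => `|Y w|) @^-1` `]-oo, e]); last first.
    by apply/seteqP; split => w /=; rewrite in_itv/= => //; case.
  by apply: measurableT_comp => //; exact: normr_measurable.
split=> //.
have mC : measurable (~` [set w | `|Y w| <= e]) by exact: measurableC.
have e2 : 0 < e ^+ 2 by rewrite exprn_gt0.
rewrite -[leLHS]fineK ?fin_num_measure// lee_fin ler_pdivlMr//.
apply: le_trans Ya.
have -> : fine (P (~` [set w | `|Y w| <= e])) * e ^+ 2 =
    \int[P]_w (e ^+ 2 * \1_(~` [set w | `|Y w| <= e]) w).
  rewrite RintegralZl//; last exact: integrable_indic.
  by rewrite mulrC /Rintegral integral_indic// setIT.
apply: le_Rintegral => //.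
  by apply: integrable_EFinZ => //; exact: integrable_indic.
move=> w _; rewrite indicE.
have [|] := boolP (w \in _); last by rewrite mulr0 sqr_ge0.
rewrite inE/= => /negP; rewrite -ltNge mulr1 => h.
by rewrite -[leRHS]real_normK ?num_real// lerXn2r// ?nnegrE ltW.
Qed.

Section block_operations.
Context {d : measure_display} {Omega : measurableType d} {R : realType}.
Variables (P : probability Omega R) (F : R -> set (set Omega)).
Hypothesis hF : filtration F.
Variable B : R -> Omega -> R.
Hypothesis hB : brownian_motion P F B.
Local Notation mu := (@lebesgue_measure R).
Local Notation block := (R * R * (Omega -> R))%type.

Lemma blocks_fun_cat (L L' : seq block) s w :
  blocks_fun (L ++ L') s w = blocks_fun L s w + blocks_fun L' s w.
Proof. exact: big_cat. Qed.

Lemma blocks_int_cat (L L' : seq block) w :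
  blocks_int B (L ++ L') w = blocks_int B L w + blocks_int B L' w.
Proof. exact: big_cat. Qed.

Lemma adapted_blocks_cat (S T : R) (L L' : seq block) :
  adapted_blocks F S T L -> adapted_blocks F S T L' -> adapted_blocks F S T (L ++ L').
Proof. by move=> h h' b; rewrite mem_cat => /orP[/h|/h']. Qed.

Lemma adapted_blocks_sub (S T S' T' : R) (L : seq block) : S' <= S -> T <= T' ->
  adapted_blocks F S T L -> adapted_blocks F S' T' L.
Proof.
move=> SS TT h b /h [h1 h2 h3 h4 h5].
by split => //; [exact: le_trans h1|exact: le_trans TT].
Qed.

Lemma blocks_fun0 (S T : R) (L : seq block) (s : R) w : adapted_blocks F S T L ->
  ~~ (S < s <= T) -> blocks_fun L s w = 0.
Proof.
move=> hL hs; rewrite /blocks_fun big1_seq// => b /andP[_ /hL[h1 h2 h3 _ _]].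
rewrite indicE mem_setE in_itv/=; case: andP => [[h4 h5]|_]; last by rewrite mulr0.
by move: hs; rewrite (le_lt_trans h1 h4) (le_trans h5 h3).
Qed.

Definition blocks_scale (f : Omega -> R) (L : seq block) : seq block :=
  [seq (b.1, fun w => f w * b.2 w) | b <- L].

Lemma blocks_scale_fun f L s w :
  blocks_fun (blocks_scale f L) s w = f w * blocks_fun L s w.
Proof.
by rewrite /blocks_fun big_map mulr_sumr; apply: eq_bigr => b _; rewrite mulrA.
Qed.

Lemma blocks_scale_int f L w :
  blocks_int B (blocks_scale f L) w = f w * blocks_int B L w.
Proof.
by rewrite /blocks_int big_map mulr_sumr; apply: eq_bigr => b _; rewrite mulrA.
Qed.

Lemma adapted_blocks_scale (S T C : R) (f : Omega -> R) (L : seq block) : 0 <= S ->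
  sub_measurable (F S) f -> (forall w, `|f w| <= C) ->
  adapted_blocks F S T L -> adapted_blocks F S T (blocks_scale f L).
Proof.
move=> S0 mf fC hL _ /mapP[b bL ->]; have [h1 h2 h3 h4 [C' hC']] := hL b bL.
split=> //=.
- apply: sub_measurableM => //.
    by apply: (filtration_sigma_algebra hF); exact: le_trans h1.
  exact: (sub_measurable_le F hF S).
- exists (C * C') => w; rewrite normrM ler_pM//.
Qed.

(** Blocks starting after S are discarded, since cutting them at S would put their end before their
    start. In [blocks_after] no filter is applied: a block that ends before S becomes the empty
    interval ]S, S]. *)
Definition blocks_before (S : R) (L : seq block) : seq block :=
  [seq (b.1.1, Num.min b.1.2 S, b.2) | b <- L & b.1.1 <= S].

Definition blocks_after (S : R) (L : seq block) : seq block :=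
  [seq (Num.max b.1.1 S, Num.max b.1.2 S, b.2) | b <- L].

Lemma adapted_blocks_before (S T : R) (L : seq block) :
  adapted_blocks F 0 T L -> adapted_blocks F 0 S (blocks_before S L).
Proof.
move=> hL b' /mapP[b + ->]; rewrite mem_filter => /andP[bS bL].
have [h1 h2 h3 h4 h5] := hL b bL.
by split => //=; [rewrite le_min h2|rewrite ge_min lexx orbT].
Qed.

Lemma adapted_blocks_after (S T : R) (L : seq block) : 0 <= S -> S <= T ->
  adapted_blocks F 0 T L -> adapted_blocks F S T (blocks_after S L).
Proof.
move=> S0 ST hL _ /mapP[b bL ->].
have [h1 h2 h3 h4 h5] := hL b bL.
split => //=.
- by rewrite le_max lexx orbT.
- by rewrite ge_max !le_max h2 lexx !orbT.
- by rewrite ge_max h3.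
- by apply: (sub_measurable_le F hF b.1.1) => //; rewrite le_max lexx.
Qed.

Lemma blocks_before_fun (S : R) L s w : s <= S ->
  blocks_fun (blocks_before S L) s w = blocks_fun L s w.
Proof.
move=> sS; rewrite /blocks_fun big_map big_filter big_mkcond; apply: eq_bigr => b _ /=.
rewrite !indicE !mem_setE !in_itv/= le_min sS andbT.
have [//|Sb] := leP b.1.1 S.
by rewrite ltNge (le_trans sS (ltW Sb)) mulr0.
Qed.

Lemma blocks_after_fun (S : R) L s w : S < s ->
  blocks_fun (blocks_after S L) s w = blocks_fun L s w.
Proof.
move=> Ss; rewrite /blocks_fun big_map; apply: eq_bigr => b _ /=.
by rewrite !indicE !mem_setE !in_itv/= gt_max Ss andbT le_max [s <= S]leNgt Ss orbF.
Qed.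

Lemma blocks_int_split (S T : R) L w : adapted_blocks F 0 T L ->
  blocks_int B L w = blocks_int B (blocks_before S L) w + blocks_int B (blocks_after S L) w.
Proof.
move=> hL; rewrite /blocks_int !big_map big_filter [X in X + _]big_mkcond -big_split/=.
apply: eq_big_seq => b /hL[_ h2 _ _ _].
have [bS|bS] := leP b.1.1 S; last first.
  by rewrite add0r (max_idPl _)// (le_trans (ltW bS)).
rewrite -mulrDr; congr (_ * _).
by case: (leP b.1.2 S) => _; ring.
Qed.

End block_operations.

(** * Increments of the Ito integral *)

Section ito_increment.
Context {d : measure_display} {Omega : measurableType d} {R : realType}.
Variables (P : probability Omega R) (F : R -> set (set Omega)).
Hypothesis hF : filtration F.
Variable B : R -> Omega -> R.
Hypothesis hB : brownian_motion P F B.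
Local Notation mu := (@lebesgue_measure R).
Local Notation block := (R * R * (Omega -> R))%type.

(* [J] is the stochastic integral of [psi] over ]S, T]; exceptional sets replace
   convergence in probability, so that no measurability is needed. *)
Definition ito_increment (S T : R) (psi : R -> Omega -> R) (J : Omega -> R) :=
  forall e : R, 0 < e -> exists (L : seq block) (G : set Omega),
    [/\ adapted_blocks F S T L, measurable G, (P (~` G) <= e%:E)%E &
        forall w, G w -> `|J w - blocks_int B L w| <= e /\
          (\int[mu]_(s in `]S, T]) ((blocks_fun L s w - psi s w) ^+ 2)%:E <= e%:E)%E].

Lemma ito_increment0 (S : R) psi : ito_increment S S psi (cst 0).
Proof.
move=> e e0; exists [::], setT; split => //.
- by rewrite setCT measure0 lee_fin ltW.
- move=> w _; rewrite /blocks_int big_nil subrr normr0 ltW//; split=> //.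
  by rewrite set_itvoc0 integral_set0 lee_fin ltW.
Qed.

Lemma measurable_sqr_sub_blocks (D : set R) (L : seq block) (f : R -> R) w :
  measurable_fun D f ->
  measurable_fun D (fun s => ((blocks_fun L s w - f s) ^+ 2)%:E).
Proof.
move=> mf; apply/measurable_EFinP; apply: measurable_funX; apply: measurable_funB => //.
by apply: measurable_funTS; exact: measurable_blocks_fun.
Qed.

(** A factor of modulus at most 1 increases neither approximation error, and being known at time S
    it keeps the blocks adapted. It will be V' at the left end of a cell. *)
Lemma ito_increment_scale (S T : R) (psi psi' : R -> Omega -> R) (J f : Omega -> R) :
  0 <= S -> sub_measurable (F S) f -> (forall w, `|f w| <= 1) ->
  (forall w, measurable_fun `]S, T] (psi ^~ w)) ->
  (forall s w, S < s <= T -> psi' s w = f w * psi s w) ->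
  ito_increment S T psi J -> ito_increment S T psi' (fun w => f w * J w).
Proof.
move=> S0 mf f1 mpsi psi'E hJ e e0; have [L [G [hL mG PG hG]]] := hJ e e0.
exists (blocks_scale f L), G; split => //; first exact: (adapted_blocks_scale F hF _ _ 1).
move=> w /hG[h1 h2]; split.
  rewrite blocks_scale_int -mulrBr normrM (le_trans _ h1)//.
  by apply: ler_piMl.
apply: le_trans h2.
have mf' : measurable_fun `]S, T] (psi' ^~ w).
  apply: (eq_measurable_fun (fun s => f w * psi s w)).
    by move=> s; rewrite inE/= in_itv/= => sST; rewrite psi'E.
  by apply: measurable_funM => //; exact: mpsi.
apply: ge0_le_integral => //.
- by move=> s _; rewrite lee_fin sqr_ge0.
- exact: measurable_sqr_sub_blocks.
- exact: measurable_sqr_sub_blocks.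
- move=> s; rewrite /= in_itv/= => sST; rewrite lee_fin blocks_scale_fun psi'E// -mulrBr exprMn.
  apply: ler_piMl; first exact: sqr_ge0.
  by rewrite -real_normK ?num_real// exprn_ile1.
Qed.

Lemma ito_increment_cat (S U T : R) (psi : R -> Omega -> R) (J J' : Omega -> R) :
  S <= U -> U <= T -> (forall w, measurable_fun `]S, T] (psi ^~ w)) ->
  ito_increment S U psi J -> ito_increment U T psi J' ->
  ito_increment S T psi (fun w => J w + J' w).
Proof.
move=> SU UT mpsi hJ hJ' e e0; have e20 : 0 < e / 2 by rewrite divr_gt0.
have [L [G [hL mG PG hG]]] := hJ _ e20; have [L' [G' [hL' mG' PG' hG']]] := hJ' _ e20.
exists (L ++ L'), (G `&` G'); split.
- by apply: adapted_blocks_cat; [apply: adapted_blocks_sub hL|apply: adapted_blocks_sub hL'].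
- exact: measurableI.
- by rewrite (splitr e); exact: probability_setCI_le.
move=> w [/hG[h1 h2] /hG'[h1' h2']]; split.
  rewrite blocks_int_cat [leRHS]splitr; apply: le_trans (lerD h1 h1').
  by rewrite opprD addrACA ler_normD.
have -> : `]S, T]%classic = `]S, U] `|` `]U, T] :> set R.
  by rewrite -itv_bndbnd_setU// bnd_simp.
rewrite ge0_integral_setU//=; last 3 first.
- apply: measurable_sqr_sub_blocks.
  by rewrite -itv_bndbnd_setU// bnd_simp.
- by move=> x _; rewrite lee_fin sqr_ge0.
- apply/disj_setPS => x [] /=; rewrite !in_itv/= => /andP[_ a1] /andP[a2 _].
  by move: (le_lt_trans a1 a2); rewrite ltxx.
rewrite (splitr e) EFinD; apply: leeD.
- apply: le_trans h2; rewrite le_eqVlt; apply/orP; left; apply/eqP.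
  apply: eq_integral => s; rewrite inE/= in_itv/= => /andP[Ss sU].
  rewrite blocks_fun_cat (blocks_fun0 F U T L') ?addr0//.
  by rewrite negb_and -leNgt sU.
- apply: le_trans h2'; rewrite le_eqVlt; apply/orP; left; apply/eqP.
  apply: eq_integral => s; rewrite inE/= in_itv/= => /andP[Us sT].
  rewrite blocks_fun_cat (blocks_fun0 F S U L) ?add0r//.
  by rewrite negb_and -ltNge Us orbT.
Qed.

(* [|Y| <= lam Y^2 + 1 / lam] controls the mean-zero variable [Y] of
   [truncated_blocks_int] off the good event. *)
Lemma ito_increment_expectation_le (S T K rho c lam : R) (psi : R -> Omega -> R)
    (J Z : Omega -> R) (G : set Omega) :
  0 <= S -> S <= T -> 0 <= c -> 0 < lam ->
  ito_increment S T psi J ->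
  (forall w, measurable_fun `]S, T] (psi ^~ w)) ->
  measurable_fun setT Z -> (forall w, `|Z w| <= K) ->
  measurable G -> (P (~` G) <= rho%:E)%E ->
  (forall w, G w -> Z w <= J w /\
    (\int[mu]_(s in `]S, T]) (psi s w ^+ 2)%:E <= c%:E)%E) ->
  \int[P]_w Z w <= 12 * lam * c + (lam^-1 + K) * rho.
Proof.
move=> S0 ST c0 lam0 hJ mpsi mZ ZK mG PG hG.
have K0 : 0 <= K by rewrite (le_trans _ (ZK point)).
have il0 : 0 <= lam^-1 by rewrite invr_ge0 ltW.
have main (e : R) : 0 < e ->
    \int[P]_w Z w <= e + 6 * lam * (2 * (c + e)) + (lam^-1 + K) * (rho + e).
  move=> e0; have [L [G' [hL mG' PG' hG']]] := hJ e e0.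
  (* On the good event the approximating blocks differ from psi by energy at most e, and psi has
     energy at most c, so their own energy is at most 2 (e + c). *)
  have N0 : 0 <= 2 * (e + c) by rewrite mulr_ge0// addr_ge0// ltW.
  have [Y [mY iY2 EY EY2 hY]] := truncated_blocks_int P F hF B hB S T L _ S0 ST hL N0.
  have iY : P.-integrable setT (EFin \o Y) by exact: sqr_integrable.
  have iZ : P.-integrable setT (EFin \o Z) by exact: (bounded_integrable P _ K).
  have mA : measurable (~` (G `&` G')) by apply: measurableC; exact: measurableI.
  have PA := probability_setCI_le P G G' rho e mG mG' PG PG'.
  have iA : P.-integrable setT (EFin \o (\1_(~` (G `&` G')) : Omega -> R)).
    exact: integrable_indic.
  have i1 := finite_measure_integrable_cst P e measurableT.
  (* On the good event Z <= J <= e + Y, because there Y is the block integral. Off it, Z <= K while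
     Y + lam Y^2 + 1 / lam >= 0. *)
  apply: (@le_trans _ _ (\int[P]_w ((e + Y w) +
      (lam * Y w ^+ 2 + (lam^-1 + K) * \1_(~` (G `&` G')) w)))).
    apply: le_Rintegral => //.
      apply: integrable_EFinD => //; apply: integrable_EFinD => //;
      exact: integrable_EFinZ.
    move=> w _; rewrite indicE.
    have [|wA] := boolP (w \in _).
      rewrite inE/= mulr1 => _; have := ZK w; rewrite ler_norml => /andP[_ ZKw].
      suff : 0 <= Y w + lam * Y w ^+ 2 + lam^-1 by move: ZKw e0; lra.
      have -> : Y w + lam * Y w ^+ 2 + lam^-1 =
        lam^-1 * (3 / 4 + (lam * Y w + 1 / 2) ^+ 2) by field; rewrite gt_eqF.
      by rewrite mulr_ge0// addr_ge0// sqr_ge0.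
    have [Gw G'w] : (G `&` G') w by move: wA; rewrite notin_setE => /contrapT.
    have [ZJ psic] := hG w Gw; have [JL Lpsi] := hG' w G'w.
    rewrite mulr0 addr0 hY; last first.
      apply: (int_sqr_le mu _ (fun s => blocks_fun L s w - psi s w) (psi ^~ w)) => //.
      - apply: measurable_funB; last exact: mpsi.
        by apply: measurable_funTS; exact: measurable_blocks_fun.
      - exact: mpsi.
      - by move=> x _; rewrite subrK.
    have : 0 <= lam * blocks_int B L w ^+ 2 by rewrite mulr_ge0 ?sqr_ge0 ?ltW.
    move: JL; rewrite ler_norml => /andP[_]; move: ZJ; lra.
  rewrite RintegralD//; last 2 first.
  - exact: integrable_EFinD.
  - by apply: integrable_EFinD => //; exact: integrable_EFinZ.
  rewrite RintegralD// RintegralD//; last 2 first.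
  - exact: integrable_EFinZ.
  - exact: integrable_EFinZ.
  rewrite RintegralZl// RintegralZl// EY addr0 Rintegral_cst//=.
  rewrite probability_setT/= mulr1 -addrA; apply: lerD => //; apply: lerD.
    by move: (ler_wpM2l (ltW lam0) EY2); lra.
  apply: ler_wpM2l; first by rewrite addr_ge0.
  rewrite /Rintegral integral_indic// setIT.
  by rewrite -lee_fin fineK// fin_num_measure.
apply/ler_addgt0Pr => eta eta0.
(* k is the coefficient of e in the bound [main], so e = eta / k turns the excess into eta. *)
pose k := 1 + 12 * lam + (lam^-1 + K).
have k0 : 0 < k by rewrite /k; move: lam0 il0 K0; lra.
have := main (eta / k) (divr_gt0 eta0 k0).
have : k * (eta / k) = eta by rewrite mulrC divfK// gt_eqF.
move: (eta / k) => e; rewrite /k => ke; nra.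
Qed.

End ito_increment.

Section ito_integral_increments.
Context {d : measure_display} {Omega : measurableType d} {R : realType}.
Variables (P : probability Omega R) (F : R -> set (set Omega)).
Hypothesis hF : filtration F.
Variable B : R -> Omega -> R.
Hypothesis hB : brownian_motion P F B.
Local Notation mu := (@lebesgue_measure R).
Local Notation block := (R * R * (Omega -> R))%type.

Definition blocks_of_simple {T : R} (f : simple_process F T) : seq block :=
  [seq (sp_time f i, sp_time f i.+1, sp_val f i) | i <- iota 0 (sp_size f)].

Lemma blocks_of_simple_fun (T : R) (f : simple_process F T) s w :
  blocks_fun (blocks_of_simple f) s w = simple_fun f s w.
Proof.
rewrite /blocks_fun /simple_fun big_map -[in LHS](subn0 (sp_size f)).
by rewrite -/(index_iota 0 (sp_size f)) big_mkord.
Qed.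

Lemma blocks_of_simple_int (T : R) (f : simple_process F T) w :
  blocks_int B (blocks_of_simple f) w = simple_integral B f w.
Proof.
rewrite /blocks_int /simple_integral big_map -[in LHS](subn0 (sp_size f)).
by rewrite -/(index_iota 0 (sp_size f)) big_mkord.
Qed.

Lemma sp_time_homo (T : R) (f : simple_process F T) i j :
  (i <= j)%N -> (j <= sp_size f)%N -> sp_time f i <= sp_time f j.
Proof.
move=> ij; rewrite -(subnKC ij); elim: (j - i)%N => [|k IH] ks; first by rewrite addn0.
rewrite addnS in ks *; apply: le_trans (IH (ltnW ks)) _.
exact: sp_time_le.
Qed.

Lemma adapted_blocks_of_simple (T : R) (f : simple_process F T) :
  adapted_blocks F 0 T (blocks_of_simple f).
Proof.
move=> _ /mapP[i + ->]; rewrite mem_iota add0n => /= fi.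
split => /=.
- by rewrite -(sp_time_first f); apply: sp_time_homo => //; exact: ltnW.
- exact: sp_time_le.
- by rewrite -[leRHS](sp_time_last f); exact: sp_time_homo.
- exact: sp_val_measurable.
- by have [C hC] := sp_val_bounded f; exists C => w; exact: hC.
Qed.

Lemma measurable_blocks_int (S T : R) (L : seq block) : 0 <= S ->
  adapted_blocks F S T L -> measurable_fun setT (blocks_int B L).
Proof.
move=> S0; rewrite /blocks_int; elim: L => [|b L IH] hL.
  under eq_fun do rewrite big_nil.
  exact: measurable_cst.
under eq_fun do rewrite big_cons.
have [h1 h2 h3 h4 h5] := hL b (mem_head _ _).
have b0 : 0 <= b.1.1 by exact: le_trans h1.
have b1 : 0 <= b.1.2 by exact: le_trans h2.
have mB u : 0 <= u -> measurable_fun setT (B u).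
  by move=> u0; apply: (sub_measurable_fun F hF u) => //; exact: (brownian_adapted hB).
apply: measurable_funD.
  apply: measurable_funM; first exact: (sub_measurable_fun F hF b.1.1).
  by apply: measurable_funB; exact: mB.
by apply: IH => b' bL'; apply: hL; rewrite in_cons bL' orbT.
Qed.

(** For a given e a single index n is enough: both convergences in probability make the
    corresponding bad events E1 and E2 of probability at most e / 2. *)
Lemma ito_integral_increment0 (T : R) (phi : R -> Omega -> R) (I : Omega -> R) :
  measurable_fun setT I ->
  (forall f : simple_process F T, measurable_fun setT (fun w =>
    \int[mu]_(s in `[0%R, T]) ((simple_fun f s w - phi s w) ^+ 2)%:E)%E) ->
  (forall w, measurable_fun `[0, T] (phi ^~ w)) ->
  ito_integral P F B T phi I -> ito_increment P F B 0 T phi I.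
Proof.
move=> mI mint mphi [f [h1 h2]] e e0.
have e20 : 0 < e / 2 by rewrite divr_gt0.
have near_le (u : nat -> \bar R) : u @ \oo --> 0%E ->
    \forall n \near \oo, (u n <= (e / 2)%:E)%E.
  move=> u0; have : nbhs (0%E : \bar R) [set y | (y < (e / 2)%:E)%E].
    by apply: open_nbhs_nbhs; split; [exact: open_ereal_lt_ereal|rewrite /= lte_fin].
  move=> n0; have : \forall n \near \oo, (u n < (e / 2)%:E)%E by exact: (u0 _ n0).
  by apply: filterS => n /ltW.
have [n [hn1 hn2]] : exists n,
    (P [set w | (e%:E <= \int[mu]_(s in `[0%R, T])
       ((simple_fun (f n) s w - phi s w) ^+ 2)%R%:E)%E] <= (e / 2)%:E)%E /\
    (P [set w | (e <= `|simple_integral B (f n) w - I w|)%R] <= (e / 2)%:E)%E.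
  near \oo => n; exists n; split; near: n; apply: near_le; [exact: h1|exact: h2].
set E1 := [set w | _] in hn1; set E2 := [set w | _] in hn2.
have mE1 : measurable E1.
  rewrite /E1 -[X in measurable X]setTI.
  exact: emeasurable_fun_c_infty.
have mE2 : measurable E2.
  have mI' : measurable_fun setT (fun w => `|simple_integral B (f n) w - I w|).
    apply: measurableT_comp => //; apply: measurable_funB => //.
    apply: (eq_measurable_fun (blocks_int B (blocks_of_simple (f n)))).
      by move=> w _; rewrite blocks_of_simple_int.
    by apply: (measurable_blocks_int 0 T) => //; exact: adapted_blocks_of_simple.
  rewrite (_ : E2 = setT `&` (fun w => `|simple_integral B (f n) w - I w|) @^-1` `[e, +oo[).
    exact: mI'.
  by apply/seteqP; split => w /=; rewrite in_itv/= andbT => //; case.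
exists (blocks_of_simple (f n)), (~` E1 `&` ~` E2); split.
- exact: adapted_blocks_of_simple.
- by apply: measurableI; exact: measurableC.
- by rewrite (splitr e); apply: probability_setCI_le; rewrite ?setCK//; exact: measurableC.
move=> w [/negP nE1 /negP nE2]; split.
  by rewrite blocks_of_simple_int distrC ltW// ltNge.
move: nE1; rewrite -ltNge => /ltW; apply: le_trans.
under eq_integral do rewrite blocks_of_simple_fun.
apply: ge0_subset_integral => //=.
- apply: (eq_measurable_fun (fun s => ((blocks_fun (blocks_of_simple (f n)) s w - phi s w) ^+ 2)%:E)).
    by move=> s _; rewrite blocks_of_simple_fun.
  apply: measurable_sqr_sub_blocks; exact: mphi.
- by move=> s _; rewrite lee_fin sqr_ge0.
- by apply: subset_itvr; rewrite bnd_simp.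
Unshelve. all: by end_near. Qed.

(** The integrals up to s and up to t come from unrelated approximations L' and L. The part of L
    before s and L' both approximate phi on ]0, s], so their difference D has small energy. By
    truncation and Chebyshev its integral is small in probability, and the part of L after s
    represents It - Is. *)
Lemma ito_increment_sub (s t : R) (phi : R -> Omega -> R) (Is It : Omega -> R) :
  0 <= s -> s <= t -> (forall w, measurable_fun `]0, t] (phi ^~ w)) ->
  ito_increment P F B 0 s phi Is -> ito_increment P F B 0 t phi It ->
  ito_increment P F B s t phi (fun w => It w - Is w).
Proof.
move=> s0 st mphi hs ht e e0.
(* D has energy at most 4 h, so its truncated integral has second moment at most 24 h and exceeds e
   / 3 with probability at most 24 h / q <= e / 2. The choice h <= e / 4 handles the two other bad
   events, 2 h <= e / 2, and the distance 2 h + e / 3 <= e. *)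
pose q := (e / 3) ^+ 2; have q0 : 0 < q by rewrite exprn_gt0// divr_gt0.
pose h := Num.min (e / 4) (e * q / 48).
have h0 : 0 < h by rewrite lt_min !divr_gt0// mulr_gt0.
have he : h <= e / 4 by rewrite ge_min lexx.
have hq : 24 * h / q <= e / 2.
  rewrite ler_pdivrMr//; have : h <= e * q / 48 by rewrite ge_min lexx orbT.
  lra.
have [L' [G' [hL' mG' PG' hG']]] := hs h h0.
have [L [G [hL mG PG hG]]] := ht h h0.
pose D := blocks_before s L ++ blocks_scale (cst (-1)) L'.
have hD : adapted_blocks F 0 s D.
  apply: adapted_blocks_cat; first exact: (adapted_blocks_before F s t).
  apply: (adapted_blocks_scale F hF 0 s 1) => //; last by move=> w; rewrite /= normrN normr1.
  by apply: sub_measurable_cst; exact: (filtration_sigma_algebra hF).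
have N0 : 0 <= 2 * (h + h) by rewrite mulr_ge0// addr_ge0// ltW.
have [Y [mY iY2 _ EY2 hY]] := truncated_blocks_int P F hF B hB 0 s D _ (lexx 0) s0 hD N0.
have e30 : 0 < e / 3 by rewrite divr_gt0.
have [mE PE] := sqr_markov P Y (e / 3) _ e30 mY iY2 EY2.
exists (blocks_after s L), (G `&` G' `&` [set w | `|Y w| <= e / 3]); split.
- exact: (adapted_blocks_after F hF s t).
- by apply: measurableI => //; exact: measurableI.
- have := probability_setCI_le P _ _ _ _ (measurableI _ _ mG mG') mE
    (probability_setCI_le P _ _ _ _ mG mG' PG PG') PE.
  move/le_trans; apply; rewrite lee_fin -/q.
  have : 6 * (2 * (h + h)) / q = 24 * h / q by congr (_ / _); ring.
  by move=> ->; lra.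
move=> w [[/hG[h1 h2] /hG'[h1' h2']] Yw].
have subs (a b : R) (f : R -> R) : 0 <= a -> a <= b -> b <= t -> measurable_fun `]0, t] f ->
    (\int[mu]_(x in `]a, b]) ((blocks_fun L x w - f x) ^+ 2)%:E <=
     \int[mu]_(x in `]0%R, t]) ((blocks_fun L x w - f x) ^+ 2)%:E)%E.
  move=> a0 ab bt mf; apply: ge0_subset_integral => //=.
  - exact: measurable_sqr_sub_blocks.
  - by move=> x _; rewrite lee_fin sqr_ge0.
  - by apply: subset_itv; rewrite bnd_simp.
split; last first.
  apply: (@le_trans _ _ h%:E); last by rewrite lee_fin; move: he e0; lra.
  apply: le_trans h2.
  apply: (le_trans _ (subs s t (phi ^~ w) s0 st (lexx t) (mphi w))).
  rewrite le_eqVlt; apply/orP; left; apply/eqP; apply: eq_integral => x.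
  by rewrite inE/= in_itv/= => /andP[sx _]; rewrite blocks_after_fun.
have Yw' : Y w = blocks_int B D w.
  have mp : measurable_fun `]0, s] (phi ^~ w).
    by apply: measurable_funS (mphi w) => //; apply: subset_itvl; rewrite bnd_simp.
  apply: hY; apply: (int_sqr_le mu _ (fun x => blocks_fun L x w - phi x w)
    (fun x => phi x w - blocks_fun L' x w)) => //.
  - by apply: measurable_funB => //; apply: measurable_funTS; exact: measurable_blocks_fun.
  - by apply: measurable_funB => //; apply: measurable_funTS; exact: measurable_blocks_fun.
  - move=> x; rewrite /= in_itv/= => /andP[_ xs].
    rewrite blocks_fun_cat blocks_before_fun// blocks_scale_fun /=; ring.
  - exact: le_trans (subs 0 s (phi ^~ w) (lexx 0) s0 st (mphi w)) h2.
  - apply: le_trans h2'; rewrite le_eqVlt; apply/orP; left; apply/eqP; apply: eq_integral => x _.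
    by rewrite -sqrrN opprB.
have -> : It w - Is w - blocks_int B (blocks_after s L) w =
    (It w - blocks_int B L w) - (Is w - blocks_int B L' w) + blocks_int B D w.
  rewrite (blocks_int_split F B s t L w hL) blocks_int_cat blocks_scale_int /=; ring.
rewrite -Yw'; apply: (le_trans (ler_normD _ _)).
apply: (le_trans (lerD (ler_normB _ _) Yw)).
by move: h1 h1' he; lra.
Qed.

End ito_integral_increments.

(** * Discretization and the mean inequality for concave functions *)

Section grid_node.
Context {R : realType}.

(* The node just below [s] of the grid of step [h] starting at [S]: on
   ]S + i h, S + (i + 1) h] it is S + i h. *)
Definition grid_node (h S s : R) : R := S + h * (Num.ceil ((s - S) / h) - 1)%:~R.

Lemma grid_node_dist (h S s : R) : 0 < h -> `|grid_node h S s - s| <= h.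
Proof.
move=> h0; rewrite /grid_node.
have /andP[c1 c2] := ceil_itv ((s - S) / h).
set c := Num.ceil _ in c1 c2 *.
rewrite ltr_pdivlMr// in c1; rewrite ler_pdivrMr// in c2.
rewrite ler_norml; apply/andP; split; move: c1 c2; rewrite intrB; lra.
Qed.

Lemma grid_node_cell (h S s : R) (i : nat) : 0 < h ->
  S + h * i%:R < s <= S + h * i.+1%:R -> grid_node h S s = S + h * i%:R.
Proof.
move=> h0 /andP[c1 c2]; rewrite /grid_node (@ceil_def _ _ (i.+1)%:Z).
  by rewrite -addn1 PoszD addrK.
rewrite ltr_pdivlMr// ler_pdivrMr// intrB -!pmulrn -natr1 in c2 *.
by apply/andP; split; lra.
Qed.

Lemma cvg_grid_node (l S s : R) : 0 < l ->
  grid_node (l / n.+1%:R) S s @[n --> \oo] --> s.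
Proof.
move=> l0; apply/cvgrPdist_le => e e0.
have h0 (n : nat) : 0 < l / n.+1%:R by rewrite divr_gt0.
near=> n; rewrite distrC (le_trans (grid_node_dist _ _ _ (h0 n)))//.
rewrite ler_pdivrMr// -ler_pdivrMl//.
have : (Num.bound (e^-1 * l) <= n)%N by near: n; exists (Num.bound (e^-1 * l)).
rewrite -(ler_nat R) => nl; apply: ltW; apply: (lt_trans (archi_boundP _)).
  by rewrite mulr_ge0 ?invr_ge0 ?ltW.
by rewrite (le_lt_trans nl)// ltr_nat.
Unshelve. all: by end_near. Qed.

End grid_node.

(** * Joint measurability of continuous processes and Fubini's theorem *)

Section joint_measurability.
Context {d : measure_display} {Omega : measurableType d} {R : realType}.
Local Notation mu := (@lebesgue_measure R).

(** The sampled process is constant in time on each cell, so a preimage is a countable union of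
    rectangles, indexed by the integer that defines the cell. *)
Lemma measurable_grid_node (X : R -> Omega -> R) (h S : R) : 0 < h ->
  (forall s, measurable_fun setT (X s)) ->
  measurable_fun setT (fun z : R * Omega => X (grid_node h S z.1) z.2).
Proof.
move=> h0 mX _ U mU; rewrite setTI.
pose A (k : int) := `]S + h * (k - 1)%:~R, S + h * k%:~R] `*`
  (X (S + h * (k - 1)%:~R) @^-1` U).
rewrite (_ : _ @^-1` U = \bigcup_k A k).
  apply: countable_bigcupT_measurable => // k; apply: measurableX => //.
  by rewrite -[X in measurable X]setTI; exact: mX.
have nodeE k s : `]S + h * (k - 1)%:~R, S + h * k%:~R]%classic s ->
    grid_node h S s = S + h * (k - 1)%:~R.
  rewrite /= in_itv/= => /andP[c1 c2]; rewrite /grid_node (@ceil_def _ _ k)//.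
  by rewrite ltr_pdivlMr// ler_pdivrMr//; apply/andP; split; lra.
apply/seteqP; split => [[s w] /= XU|[s w] /= [q _ [/= /nodeE ->]]//].
have /andP[c1 c2] := ceil_itv ((s - S) / h).
set c := Num.ceil _ in c1 c2.
have sc : `]S + h * (c - 1)%:~R, S + h * c%:~R]%classic s.
  rewrite ltr_pdivlMr// in c1; rewrite ler_pdivrMr// in c2.
  by rewrite /= in_itv/=; apply/andP; split; lra.
by exists c.
Qed.

(** A process with continuous paths is the pointwise limit of its samplings on grids of step 1 / (n
    + 1). *)
Lemma joint_measurable (X : R -> Omega -> R) :
  (forall s, measurable_fun setT (X s)) -> (forall w, continuous (X ^~ w)) ->
  measurable_fun setT (fun z : R * Omega => X z.1 z.2).
Proof.
move=> mX cX.
apply: (@measurable_fun_cvg _ _ _ _ (fun n z => X (grid_node (1 / n.+1%:R) 0 z.1) z.2)).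
  by move=> n; apply: measurable_grid_node => //; rewrite divr_gt0.
move=> [s w] _ /=.
apply: (@cvg_comp _ _ _ (fun n : nat => grid_node (1 / n.+1%:R) 0 s) (X ^~ w) _ (nbhs s)).
  exact: cvg_grid_node.
exact: cX.
Qed.

Lemma measurable_fun_int (D : set R) (f : R -> Omega -> \bar R) : measurable D ->
  measurable_fun setT (fun z : R * Omega => f z.1 z.2) ->
  (forall s w, (0 <= f s w)%E) ->
  measurable_fun setT (fun w => \int[mu]_(s in D) f s w)%E.
Proof.
move=> mD mf f0.
have fE w : (\int[mu]_(s in D) f s w = \int[mu]_s (f s w * (\1_D s)%:E))%E.
  rewrite integral_mkcond; apply: eq_integral => s _.
  by rewrite patchE indicE; case: ifP; rewrite ?mule1 ?mule0.
under eq_fun do rewrite fE.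
apply: (measurable_fun_fubini_tonelli_G (m1 := mu) (fun z => f z.1 z.2 * (\1_D z.1)%:E)%E).
  apply: emeasurable_funM => //; apply/measurable_EFinP.
  by apply: measurableT_comp => //; exact: measurable_indic.
by move=> z; rewrite mule_ge0// lee_fin.
Qed.

Variable P : probability Omega R.

Lemma bounded_fubini (S T C : R) (f : R -> Omega -> R) :
  measurable_fun setT (fun z : R * Omega => f z.1 z.2) ->
  (forall s w, S < s <= T -> `|f s w| <= C) ->
  [/\ measurable_fun setT (fun w => \int[mu]_(s in `]S, T]) f s w),
      measurable_fun `]S, T] (fun s => \int[P]_w f s w) &
      \int[P]_w \int[mu]_(s in `]S, T]) f s w = \int[mu]_(s in `]S, T]) \int[P]_w f s w].
Proof.
move=> mf fC.
(* The bound on f is available on ]S, T] only; cut off there, f becomes integrable for the product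
   of P with Lebesgue measure on the whole line. *)
pose g (z : R * Omega) := f z.1 z.2 * \1_(`]S, T]) z.1.
have gE s w : g (s, w) = ((fun s => f s w) \_ `]S, T]) s.
  by rewrite /g patchE indicE; case: ifP; rewrite ?mulr1 ?mulr0.
have gC s w : `|g (s, w)| <= `|C| * \1_(`]S, T]) s.
  rewrite /g/= indicE mem_setE in_itv/=.
  have [sST|_] := boolP (S < s <= T); rewrite ?mulr1 ?mulr0 ?normr0//.
  by rewrite (le_trans (fC _ _ sST))// ler_norm.
have mg : measurable_fun setT g.
  by apply: measurable_funM => //; apply: measurableT_comp.
have mgE : measurable_fun setT (fun z => `|g z|%:E).
  by apply/measurable_EFinP; apply: measurableT_comp.
have mg1 s : measurable_fun setT (fun w => g (s, w)) by exact: measurable_fun_pair2.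
have mg2 w : measurable_fun setT (fun s => g (s, w)) by exact: measurable_fun_pair1.
have muST : (mu `]S, T] < +oo)%E.
  by rewrite lebesgue_measure_itv/=; case: ifP; rewrite ?ltry// -EFinB ltry.
have mC1 : measurable_fun setT (fun s : R => (`|C| * \1_(`]S, T]) s)%:E).
  by apply/measurable_EFinP; apply: measurable_funM.
have iC : (\int[mu]_s (`|C| * \1_(`]S, T]) s)%:E < +oo)%E.
  under eq_integral do rewrite EFinM.
  rewrite ge0_integralZl_EFin//; last exact/measurable_EFinP.
  by rewrite integral_indic// setIT lte_mul_pinfty.
have ig1 s : P.-integrable setT (EFin \o (fun w => g (s, w))).
  exact: (bounded_integrable P _ (`|C| * \1_(`]S, T]) s)).
have ig2 w : mu.-integrable setT (EFin \o (fun s => g (s, w))).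
  apply/integrableP; split; first by apply/measurable_EFinP; exact: mg2.
  apply: le_lt_trans iC; apply: ge0_le_integral => //.
  - apply/measurable_EFinP; apply: measurableT_comp => //; exact: mg2.
  - by move=> s _ /=; rewrite lee_fin.
have ig : (mu \x P)%E.-integrable setT (EFin \o g).
  apply/integrable12ltyP; first exact/measurable_EFinP.
  apply: le_lt_trans iC; apply: ge0_le_integral => //.
  - by move=> s _; exact: integral_ge0.
  - exact: (measurable_fun_fubini_tonelli_F (fun z => `|g z|%:E)).
  - move=> s _; apply: (@le_trans _ _ (\int[P]_w (`|C| * \1_(`]S, T]) s)%:E)%E).
      apply: ge0_le_integral => //.
      + apply/measurable_EFinP; apply: measurableT_comp => //; exact: mg1.
      + by move=> w _ /=; rewrite lee_fin.
    by rewrite integral_cst//= probability_setT mule1.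
have intE w : \int[mu]_(s in `]S, T]) f s w = \int[mu]_s g (s, w).
  by rewrite Rintegral_mkcond; under [in RHS]eq_Rintegral do rewrite gE.
have gST s : s \in `]S, T]%classic -> \int[P]_w g (s, w) = \int[P]_w f s w.
  by move=> sST; apply: eq_Rintegral => w _; rewrite gE patchE sST.
split.
- under eq_fun do rewrite intE.
  exact: (measurableT_comp (@fine_measurable R setT measurableT) (measurable_fubini_G ig)).
- apply: (eq_measurable_fun (fun s => \int[P]_w g (s, w))); first exact: gST.
  apply: measurable_funTS.
  exact: (measurableT_comp (@fine_measurable R setT measurableT) (measurable_fubini_F ig)).
- under eq_Rintegral do rewrite intE.
  transitivity (\int[mu]_s \int[P]_w g (s, w)).
    congr fine; transitivity (\int[P]_w \int[mu]_s (EFin \o g) (s, w))%E.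
      by apply: eq_integral => w _; rewrite fineK//; exact: integrable_fin_num (ig2 w).
    rewrite -(Fubini ig).
    by apply: eq_integral => s _; rewrite fineK//; exact: integrable_fin_num (ig1 s).
  rewrite [RHS]Rintegral_mkcond; apply: eq_Rintegral => s _.
  rewrite patchE; case: ifPn => [/gST//|sST].
  by under eq_Rintegral do rewrite gE patchE (negbTE sST); rewrite Rintegral_cst// mul0r.
Qed.

End joint_measurability.

Lemma cvge_near_le {R : realType} (u : nat -> \bar R) (l a : \bar R) :
  u @ \oo --> l -> (l < a)%E -> exists n, forall k, (n <= k)%N -> (u k <= a)%E.
Proof.
move=> ul la.
have n0 : nbhs l [set y | (y < a)%E] by apply: open_nbhs_nbhs; split; [exact: open_ereal_lt_ereal|].
have [n _ hn] : \forall n \near \oo, (u n < a)%E by exact: (ul _ n0).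
by exists n => k nk; apply: ltW; exact: hn.
Qed.

(** Continuity from above: the tail unions of the complements decrease to the empty set. This turns
    limits along each path into an event of large probability. *)
Lemma eventually_probability {d : measure_display} {T : measurableType d} {R : realType}
    (P : probability T R) (A : nat -> set T) (rho : R) : 0 < rho ->
  (forall n, measurable (A n)) ->
  (forall w, exists n, forall k, (n <= k)%N -> A k w) ->
  exists n, (P (~` A n) <= rho%:E)%E.
Proof.
move=> rho0 mA hA.
pose U n := \bigcup_(k in [set k | (n <= k)%N]) ~` A k.
have mU n : measurable (U n) by apply: bigcup_measurable => k _; exact: measurableC.
have mI : measurable (\bigcap_n U n) by exact: bigcapT_measurable.
have : P \o U @ \oo --> P (\bigcap_n U n).
  apply: nonincreasing_cvg_mu => //.
  - by rewrite -ge0_fin_numE// fin_num_measure.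
  - move=> m n mn; apply/subsetPset => w [k nk Akw]; exists k => //=.
    exact: leq_trans nk.
have -> : \bigcap_n U n = set0.
  rewrite -subset0 => w hw; have [n hn] := hA w.
  by have [k nk] := hw n I; apply; exact: hn.
rewrite measure0 => PU0; have [|n hn] := cvge_near_le _ _ rho%:E PU0; first by rewrite lte_fin.
exists n; apply: le_trans (hn n (leqnn n)).
apply: le_measure; rewrite ?inE//; first exact: measurableC.
by move=> w nA; exists n => /=.
Qed.

Section continuous_integrals.
Context {R : realType}.
Local Notation mu := (@lebesgue_measure R).

Lemma continuous_itv_integrable (f : R -> R) (S T : R) : continuous f ->
  mu.-integrable `]S, T] (EFin \o f).
Proof.
move=> cf; apply: (@integrableS _ _ _ mu `[S, T]) => //.
- by apply: subset_itvr; rewrite bnd_simp.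
- apply: continuous_compact_integrable; first exact: segment_compact.
  exact: continuous_subspaceT.
Qed.

Lemma mul_continuous_itv_integrable (f p : R -> R) (S T C : R) : continuous f ->
  measurable_fun setT p -> (forall s, `|p s| <= C) ->
  mu.-integrable `]S, T] (EFin \o (fun s => p s * f s)).
Proof.
move=> cf mp pC.
apply: (@le_integrable _ _ _ mu _ _ _ (EFin \o (fun s => C * f s))) => //.
- apply/measurable_EFinP; apply: measurable_funTS; apply: measurable_funM => //.
  exact: continuous_measurable_fun.
- by move=> s _ /=; rewrite lee_fin !normrM ler_wpM2r// (le_trans (pC s))// ler_norm.
- by apply: integrable_EFinZ => //; exact: continuous_itv_integrable.
Qed.

Lemma Rintegral_itv_cat (f : R -> R) (S U T : R) : S <= U -> U <= T ->
  mu.-integrable `]S, T] (EFin \o f) ->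
  \int[mu]_(s in `]S, T]) f s = \int[mu]_(s in `]S, U]) f s + \int[mu]_(s in `]U, T]) f s.
Proof.
move=> SU UT jf.
have STE : `]S, T]%classic = `]S, U] `|` `]U, T] :> set R.
  by rewrite -itv_bndbnd_setU// bnd_simp.
rewrite STE Rintegral_setU//=; first by rewrite -STE.
apply/disj_setPS => x [] /=; rewrite !in_itv/= => /andP[_ a1] /andP[a2 _].
by move: (le_lt_trans a1 a2); rewrite ltxx.
Qed.

End continuous_integrals.

Section concave_dynkin.
Context {d : measure_display} {Omega : measurableType d} {R : realType}.
Variables (P : probability Omega R) (F : R -> set (set Omega)).
Hypothesis hF : filtration F.
Variable B : R -> Omega -> R.
Hypothesis hB : brownian_motion P F B.
Local Notation mu := (@lebesgue_measure R).

Variables (X b g : R -> Omega -> R) (V V' : R -> R) (N K c : R).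
Hypothesis adX : adapted F X.
Hypotheses (cX : forall w, continuous (X ^~ w)) (mX : forall s, measurable_fun setT (X s)).
Hypotheses (cb : forall w, continuous (b ^~ w)) (mb : forall s, measurable_fun setT (b s)).
Hypotheses (cg : forall w, continuous (g ^~ w)) (mg : forall s, measurable_fun setT (g s)).
Hypothesis X_gt0 : forall s w, 0 < X s w.
Hypothesis concaveV : forall y z, 0 < y -> 0 < z -> V z - V y <= V' y * (z - y).
Hypotheses (mV : measurable_fun setT V) (V_le : forall y, `|V y| <= N).
Hypotheses (cV' : continuous V') (V'_le1 : forall y, `|V' y| <= 1).
Hypothesis drift_le : forall s w, `|V' (X s w) * b s w| <= K.
Hypothesis diffusion_le : forall s w, (V' (X s w) * g s w) ^+ 2 <= c.
Hypothesis increments : forall s t, 0 <= s -> s <= t -> exists J : Omega -> R,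
  ito_increment P F B s t g J /\
  {ae P, forall w, X t w - X s w = \int[mu]_(u in `]s, t]) b u w + J w}.

Variables S T : R.
Hypotheses (S0 : 0 <= S) (ST : S < T).

Let l := T - S.
Let l0 : 0 < l. Proof. by rewrite subr_gt0. Qed.
Let mV' : measurable_fun setT V'. Proof. exact: continuous_measurable_fun. Qed.

Let Phi (n : nat) (s : R) (w : Omega) : R := V' (X (grid_node (l / n.+1%:R) S s) w).

Let h0 (n : nat) : 0 < l / n.+1%:R. Proof. by rewrite divr_gt0. Qed.

Let jX : measurable_fun setT (fun z : R * Omega => X z.1 z.2).
Proof. exact: joint_measurable. Qed.
Let jb : measurable_fun setT (fun z : R * Omega => b z.1 z.2).
Proof. exact: joint_measurable. Qed.
Let jg : measurable_fun setT (fun z : R * Omega => g z.1 z.2).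
Proof. exact: joint_measurable. Qed.
Let jPhi n : measurable_fun setT (fun z : R * Omega => Phi n z.1 z.2).
Proof. by apply: measurableT_comp => //; exact: measurable_grid_node. Qed.
Let mPhi n w : measurable_fun setT (Phi n ^~ w).
Proof. exact: (measurable_fun_pair1 w (jPhi n)). Qed.
Let jV'X : measurable_fun setT (fun z : R * Omega => V' (X z.1 z.2)).
Proof. exact: measurableT_comp. Qed.

Let Phi_b_integrable n w u v : mu.-integrable `]u, v] (EFin \o (fun s => Phi n s w * b s w)).
Proof. by apply: (mul_continuous_itv_integrable _ _ _ _ 1) => // s; exact: V'_le1. Qed.

Let cvg_Phi s w : Phi n s w @[n --> \oo] --> V' (X s w).
Proof.
apply: (@cvg_comp _ _ _ (fun n : nat => grid_node (l / n.+1%:R) S s) (fun u => V' (X u w)) _ (nbhs s)).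
  exact: cvg_grid_node.
apply: (@cvg_comp _ _ _ (X ^~ w) V' _ (nbhs (X s w))); [exact: cX|exact: cV'].
Qed.

(* The Euler scheme: on each cell concavity bounds the increment of V by its
   linearization at the left end point. *)
Lemma euler_step (n i : nat) : exists J : Omega -> R,
  ito_increment P F B S (S + l / n.+1%:R * i%:R) (fun s w => Phi n s w * g s w) J /\
  {ae P, forall w, V (X (S + l / n.+1%:R * i%:R) w) - V (X S w) <=
    \int[mu]_(s in `]S, S + l / n.+1%:R * i%:R]) (Phi n s w * b s w) + J w}.
Proof.
set h := l / n.+1%:R; have hpos : 0 < h := h0 n.
elim: i => [|i [J [hJ1 hJ2]]].
  exists (cst 0); rewrite mulr0 addr0; split; first exact: ito_increment0.
  by apply: aeW => w; rewrite set_itvoc0 Rintegral_set0 subrr addr0.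
set t := S + h * i%:R in hJ1 hJ2; set t' := S + h * i.+1%:R.
have St : S <= t by rewrite lerDl mulr_ge0// ltW.
have t0 : 0 <= t by exact: le_trans St.
have tt' : t <= t' by rewrite lerD2l ler_wpM2l ?ler_nat// ltW.
have [J' [hJ'1 hJ'2]] := increments t t' t0 tt'.
have mPg w (u v : R) : measurable_fun `]u, v] (fun s => Phi n s w * g s w).
  apply: measurable_funTS; apply: measurable_funM; first exact: mPhi.
  by apply: continuous_measurable_fun; exact: cg.
(* On the new cell Phi is frozen at V'(X t), which can be taken out of the drift integral and
   multiplies the increment J' of the stochastic integral. *)
have node s : t < s <= t' -> grid_node h S s = t by exact: grid_node_cell.
exists (fun w => J w + V' (X t w) * J' w); split.
  apply: (ito_increment_cat P F B S t t') => //.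
  apply: (ito_increment_scale P F hF B t t' g _ J' (fun w => V' (X t w))) => //.
  - apply: (sub_measurable_comp _ _ V' (X t)) => //; last exact: adX.
    exact: (filtration_sigma_algebra hF).
  - by move=> w; apply: measurable_funTS; apply: continuous_measurable_fun; exact: cg.
  - by move=> s w /node; rewrite /Phi -/h => ->.
apply: filterS2 hJ2 hJ'2 => w hw hw'.
rewrite (Rintegral_itv_cat _ S t t')//.
have -> : \int[mu]_(s in `]t, t']) (Phi n s w * b s w) =
    V' (X t w) * \int[mu]_(s in `]t, t']) b s w.
  rewrite -RintegralZl//; last exact: continuous_itv_integrable.
  apply: eq_Rintegral => s; rewrite inE/= in_itv/= => /node.
  by rewrite /Phi -/h => ->.
have := concaveV (X t w) (X t' w) (X_gt0 t w) (X_gt0 t' w).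
by rewrite hw' mulrDr; move: hw; lra.
Qed.

(** The cost, in the drift integral, of replacing the sampled derivative by V'(X s). *)
Let err n w := (\int[mu]_(s in `]S, T]) `|((Phi n s w - V' (X s w)) * b s w)%R|%:E)%E.
Let energy n w := (\int[mu]_(s in `]S, T]) (((Phi n s w * g s w) ^+ 2)%R)%:E)%E.

Let cvg_err w : err n w @[n --> \oo] --> 0%E.
Proof.
have := @dominated_cvg _ _ R mu `]S, T]%classic (measurable_itv _)
  (fun n s => (`|(Phi n s w - V' (X s w)) * b s w|)%:E) (cst 0%E)
  (fun s => (2 * `|b s w|)%:E).
rewrite integral0; apply.
- move=> n; apply/measurable_EFinP; apply: measurable_funTS.
  apply: measurableT_comp => //; apply: measurable_funM.
    apply: measurable_funB; first exact: mPhi.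
    exact: (measurable_fun_pair1 w jV'X).
  by apply: continuous_measurable_fun; exact: cb.
- move=> s _; apply: cvg_EFin; first by near=> n.
  rewrite -[X in _ --> X](normr0 R) -[X in `|X|](mul0r (b s w)).
  apply: cvg_norm; apply: cvgMl; rewrite -(subrr (V' (X s w))).
  by apply: cvgB; [exact: cvg_Phi|exact: cvg_cst].
- by [].
- apply: integrable_EFinZ => //; apply: continuous_itv_integrable => s.
  apply: (@cvg_comp _ _ _ (b ^~ w) (fun x => `|x|) _ (nbhs (b s w))); [exact: cb|exact: norm_continuous].
- move=> n s _; rewrite /= lee_fin normr_id normrM ler_wpM2r//.
  apply: (le_trans (ler_normB _ _)); rewrite -[2]/(1 + 1).
  by rewrite lerD//; exact: V'_le1.
Unshelve. all: by end_near. Qed.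

(** The bound c concerns V'(X s) g s, with both factors at time s, and not the sampled integrand.
    Domination by g^2, integrable on each path, carries the bound over for n large depending on
    w. *)
Let cvg_energy w : energy n w @[n --> \oo] -->
  (\int[mu]_(s in `]S, T]) ((V' (X s w) * g s w) ^+ 2)%:E)%E.
Proof.
apply: (@dominated_cvg _ _ R mu `]S, T]%classic (measurable_itv _)
  (fun n s => ((Phi n s w * g s w) ^+ 2)%:E) _ (fun s => (g s w ^+ 2)%:E)).
- move=> n; apply/measurable_EFinP; apply: measurable_funTS; apply: measurable_funX.
  apply: measurable_funM; first exact: mPhi.
  by apply: continuous_measurable_fun; exact: cg.
- move=> s _; apply: cvg_EFin; first by near=> n.
  apply: (@cvg_comp _ _ _ (fun n => Phi n s w * g s w) (fun x => x ^+ 2) _ (nbhs (V' (X s w) * g s w))).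
    by apply: cvgMl; exact: cvg_Phi.
  exact: exprn_continuous.
- by [].
- apply: continuous_itv_integrable => s.
  apply: (@cvg_comp _ _ _ (g ^~ w) (fun x => x ^+ 2) _ (nbhs (g s w))); [exact: cg|exact: exprn_continuous].
- move=> n s _; rewrite /= lee_fin ger0_norm ?sqr_ge0// exprMn ler_piMl ?sqr_ge0//.
  by rewrite -real_normK ?num_real// exprn_ile1//; exact: V'_le1.
Unshelve. all: by end_near. Qed.

Let limit_energy_le w :
  (\int[mu]_(s in `]S, T]) ((V' (X s w) * g s w) ^+ 2)%:E <= (c * l)%:E)%E.
Proof.
apply: (@le_trans _ _ (\int[mu]_(s in `]S, T]) (cst c%:E) s)%E).
  apply: ge0_le_integral => //.
  - by move=> s _; rewrite lee_fin sqr_ge0.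
  - apply/measurable_EFinP; apply: measurable_funTS; apply: measurable_funX.
    apply: measurable_funM; first exact: (measurable_fun_pair1 w jV'X).
    by apply: continuous_measurable_fun; exact: cg.
  - by move=> s _; rewrite lee_fin.
by rewrite integral_cst//= lebesgue_measure_itv/= lte_fin ST -EFinB -EFinM.
Qed.

Let c0 : 0 <= c. Proof. by rewrite (le_trans _ (diffusion_le 0 point))// sqr_ge0. Qed.

Let K0 : 0 <= K. Proof. by rewrite (le_trans _ (drift_le 0 point)). Qed.

Let N0 : 0 <= N. Proof. by rewrite (le_trans _ (V_le 0)). Qed.

Lemma concave_dynkin :
  \int[P]_w V (X T w) - \int[P]_w V (X S w) <=
  \int[P]_w \int[mu]_(s in `]S, T]) (V' (X s w) * b s w).
Proof.
have jD : measurable_fun setT (fun z : R * Omega => V' (X z.1 z.2) * b z.1 z.2).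
  exact: measurable_funM.
have [mD _ _] := bounded_fubini P S T K _ jD (fun s w _ => drift_le s w).
pose D w := \int[mu]_(s in `]S, T]) (V' (X s w) * b s w).
have iV'b w : mu.-integrable `]S, T] (EFin \o (fun s => V' (X s w) * b s w)).
  apply: (mul_continuous_itv_integrable _ _ _ _ 1) => //.
  exact: (measurable_fun_pair1 w jV'X).
have DK w : `|D w| <= K * l.
  have mST : measurable (`]S, T]%classic : set (measurableTypeR R)) by exact: measurable_itv.
  rewrite /D; apply: (le_trans (le_normr_Rintegral mST (iV'b w))).
  have -> : K * l = \int[mu]_(s in `]S, T]) (cst K s).
    by rewrite Rintegral_cst//= lebesgue_measure_itv/= lte_fin ST.
  apply: le_Rintegral => //.
  - exact: (integrable_norm (iV'b w)).
  - apply: continuous_itv_integrable; exact: cst_continuous.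
have iD : P.-integrable setT (EFin \o D) by exact: (bounded_integrable P _ (K * l)).
have iV t : P.-integrable setT (EFin \o (fun w => V (X t w))).
  by apply: (bounded_integrable P _ N) => //; exact: measurableT_comp.
pose Z w := V (X T w) - V (X S w) - D w.
pose M := N + N + K * l.
have ZM w : `|Z w| <= M.
  apply: (le_trans (ler_normB _ _)); rewrite lerD//.
  by apply: (le_trans (ler_normB _ _)); rewrite lerD.
have mZ : measurable_fun setT Z.
  by apply: measurable_funB => //; apply: measurable_funB; exact: measurableT_comp.
have ZE : \int[P]_w Z w = \int[P]_w V (X T w) - \int[P]_w V (X S w) - \int[P]_w D w.
  rewrite /Z RintegralB// ?RintegralB//.
  by apply: (bounded_integrable P _ (N + N)) => //; [apply: measurable_funB; exact: measurableT_comp|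
    move=> w _; apply: (le_trans (ler_normB _ _)); rewrite lerD].
suff : \int[P]_w Z w <= 0 by rewrite ZE subr_le0.
apply/ler_addgt0Pr => eta eta0; rewrite add0r.
(* The margin 1 lets the energies, whose limit is at most c l, fall eventually below c'. The three
   terms of the final estimate are each made equal to eta / 3: delta, 12 lam c' and k rho. None of
   these constants depends on n, which is chosen next. *)
pose c' := c * l + 1.
have c'0 : 0 < c' by rewrite ltr_pwDr// mulr_ge0// ltW.
pose delta := eta / 3; have delta0 : 0 < delta by rewrite divr_gt0.
pose lam := eta / (36 * c'); have lam0 : 0 < lam by rewrite divr_gt0// mulr_gt0.
pose k := lam^-1 + (M + delta).
have k0 : 0 < k.
  by rewrite ltr_pwDl ?invr_gt0// addr_ge0 ?(ltW delta0)// !addr_ge0// mulr_ge0// ltW.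
pose rho := eta / (3 * k); have rho0 : 0 < rho by rewrite divr_gt0// mulr_gt0.
pose A n := [set w | (err n w <= delta%:E)%E] `&` [set w | (energy n w <= c'%:E)%E].
have merr n : measurable_fun setT (err n).
  apply: measurable_fun_int => //.
  apply/measurable_EFinP; apply: measurableT_comp => //.
  by apply: measurable_funM => //; exact: measurable_funB.
have menergy n : measurable_fun setT (energy n).
  apply: measurable_fun_int => //; last by move=> s w; rewrite lee_fin sqr_ge0.
  by apply/measurable_EFinP; apply: measurable_funX; exact: measurable_funM.
have mA n : measurable (A n).
  apply: measurableI; rewrite -[X in measurable X]setTI; exact: emeasurable_fun_infty_c.
have [n PAn] : exists n, (P (~` A n) <= rho%:E)%E.
  apply: eventually_probability => // w.
  have [|n1 h1] := cvge_near_le _ _ delta%:E (cvg_err w); first by rewrite lte_fin.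
  have [|n2 h2] := cvge_near_le _ _ c'%:E (cvg_energy w).
    by apply: le_lt_trans (limit_energy_le w) _; rewrite lte_fin ltrDl.
  exists (maxn n1 n2) => m; rewrite geq_max => /andP[m1 m2].
  by split; [exact: h1|exact: h2].
have [J [hJ [N1 [mN1 PN1 hN1]]]] := euler_step n n.+1.
have TE : S + l / n.+1%:R * n.+1%:R = T by rewrite divfK// /l addrC subrK.
rewrite TE in hJ hN1.
have mG : measurable (A n `&` ~` N1) by apply: measurableI => //; exact: measurableC.
have PG : (P (~` (A n `&` ~` N1)) <= rho%:E)%E.
  rewrite -[rho]addr0; apply: probability_setCI_le => //; first exact: measurableC.
  by rewrite setCK PN1.
have i1 : P.-integrable setT (EFin \o cst delta) by exact: finite_measure_integrable_cst.
have iZ : P.-integrable setT (EFin \o Z) by exact: (bounded_integrable P _ M).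
(* The variable is Z - delta: on the good event the Euler estimate gives Z <= J + err, and err is at
   most delta there. *)
have := ito_increment_expectation_le P F hF B hB S T (M + delta) rho c' lam
  (fun s w => Phi n s w * g s w) J (fun w => Z w - delta) _ S0 (ltW ST) (ltW c'0) lam0 hJ.
move=> /(_ _ _ _ _ mG PG).
rewrite RintegralB// Rintegral_cst//= probability_setT/= mulr1.
move=> main.
have : \int[P]_w Z w - delta <= 12 * lam * c' + k * rho.
  apply: main.
  - move=> w; apply: measurable_funTS; apply: measurable_funM; first exact: mPhi.
    by apply: continuous_measurable_fun; exact: cg.
  - by apply: measurable_funB.
  - move=> w; apply: (le_trans (ler_normB _ _)); rewrite lerD//.
    by rewrite ger0_norm// ltW.
  - move=> w [[he hen] nN1]; split; last exact: hen.
    have : V (X T w) - V (X S w) <= \int[mu]_(s in `]S, T]) (Phi n s w * b s w) + J w.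
      by apply: contrapT => hw; apply: nN1; apply: hN1.
    have : \int[mu]_(s in `]S, T]) (Phi n s w * b s w) - D w <= delta.
      have mST : measurable (`]S, T]%classic : set (measurableTypeR R)) by exact: measurable_itv.
      rewrite /D -RintegralB//; apply: (le_trans (ler_norm _)).
      have iB : mu.-integrable `]S, T]
          (EFin \o (fun s => Phi n s w * b s w - V' (X s w) * b s w)).
        apply: (integrable_EFinD mu _ mST) => //.
        rewrite (_ : (fun s => _) = (fun s => -1 * (V' (X s w) * b s w))).
          exact: integrable_EFinZ.
        by apply/funext => s; rewrite mulN1r.
      apply: (le_trans (le_normr_Rintegral mST iB)).
      rewrite -lee_fin fineK; last exact: (integrable_fin_num mST (integrable_norm iB)).
      by under eq_integral do rewrite -mulrBl.
    by rewrite /Z; lra.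
have -> : 12 * lam * c' = eta / 3 by rewrite /lam; field; rewrite gt_eqF.
have -> : k * rho = eta / 3 by rewrite /rho; field; rewrite gt_eqF.
by rewrite /delta; lra.
Qed.

End concave_dynkin.

(** * The logistic integral inequality *)

Section limf_einf_pinfty.
Context {R : realType}.

Lemma limf_einf_pinfty_ge (f : R -> \bar R) (c : \bar R) (t0 : R) :
  (forall t, t0 <= t -> (c <= f t)%E) -> (c <= limf_einf f (pinfty_nbhs R))%E.
Proof.
move=> hc; rewrite limf_einfE.
apply: (@le_trans _ _ (ereal_inf (f @` [set t | t0 < t]))).
  by apply: le_ereal_inf_tmp => _ [t /= t0t <-]; apply: hc; exact: ltW.
apply: ereal_sup_ubound; exists [set t | t0 < t] => //.
by exists t0; split; [exact: num_real|].
Qed.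

Lemma limf_einf_pinfty_gt0 (f : R -> \bar R) : (0 < limf_einf f (pinfty_nbhs R))%E ->
  exists (t0 delta : R), 0 < delta /\ forall t, t0 <= t -> (delta%:E <= f t)%E.
Proof.
rewrite limf_einfE => /ereal_sup_gt[_ [U [t0 [_ tU]] <-]] inf0.
have [e e0 einf] : exists2 e : R, 0 < e & (e%:E <= ereal_inf (f @` U))%E.
  move: inf0; case: (ereal_inf _) => [x| |//] x0; first by exists x.
  by exists 1 => //; exact: leey.
exists (t0 + 1), e; split => // t t0t; apply: (le_trans einf).
apply: ereal_inf_lbound; exists t => //; apply: tU.
by rewrite (lt_le_trans _ t0t)// ltrDl.
Qed.

End limf_einf_pinfty.

Section logistic_inequality.
Context {R : realType}.
Local Notation mu := (@lebesgue_measure R).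

Lemma bounded_itv_integrable (f : R -> R) (S T C : R) :
  measurable_fun `]S, T] f -> (forall s, S < s <= T -> `|f s| <= C) ->
  mu.-integrable `]S, T] (EFin \o f).
Proof.
move=> mf fC.
apply: (@le_integrable _ _ _ mu _ _ _ (EFin \o cst C)) => //.
- exact/measurable_EFinP.
- move=> s; rewrite /= in_itv/= => sST; rewrite lee_fin (le_trans (fC _ sST))//.
  exact: ler_norm.
- by apply: continuous_itv_integrable; exact: cst_continuous.
Qed.

Lemma Rintegral_itv_cst (c S T : R) : S <= T -> \int[mu]_(s in `]S, T]) c = c * (T - S).
Proof.
move=> ST; rewrite Rintegral_cst//= lebesgue_measure_itv/= lte_fin.
case: ltP => [//|TS]; have -> : T = S by apply/eqP; rewrite eq_le TS ST.
by rewrite subrr.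
Qed.

Variables (m a : R -> R) (rb ab N : R).
Hypotheses (rb0 : 0 < rb) (mN : forall t, 0 <= m t <= N).
Hypotheses (a_ge0 : forall t : R, 0 <= t -> 0 <= a t) (a_le : forall t : R, 0 <= t -> a t <= ab).
Hypotheses (mm : forall S T : R, measurable_fun `]S, T] m)
  (ma : forall S T : R, 0 <= S -> measurable_fun `]S, T] a).
Hypothesis m_le : forall S T : R, 0 <= S -> S <= T ->
  m T - m S <= \int[mu]_(s in `]S, T]) (rb * m s - a s * m s ^+ 2).

Let N0 : 0 <= N. Proof. by have /andP[h1 h2] := mN 0; exact: le_trans h2. Qed.

Let norm_m t : `|m t| <= N. Proof. by have /andP[h1 h2] := mN t; rewrite ger0_norm. Qed.


Let integrable_a (S T : R) : 0 <= S -> mu.-integrable `]S, T] (EFin \o a).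
Proof.
move=> S0; apply: (bounded_itv_integrable _ _ _ ab); first exact: ma.
move=> s /andP[Ss _]; have s0 : 0 <= s by rewrite (le_trans S0)// ltW.
by rewrite ger0_norm ?a_le// a_ge0.
Qed.

Let integrable_drift (S T : R) : 0 <= S ->
  mu.-integrable `]S, T] (EFin \o (fun s => rb * m s - a s * m s ^+ 2)).
Proof.
move=> S0; apply: (bounded_itv_integrable _ _ _ (rb * N + ab * N ^+ 2)).
  apply: measurable_funB; first exact: measurable_funM.
  by apply: measurable_funM; [exact: ma|exact: measurable_funX].
move=> s /andP[Ss _]; have s0 : 0 <= s by rewrite (le_trans S0)// ltW.
have /andP[m0 mN'] := mN s.
apply: (le_trans (ler_normB _ _)); rewrite !normrM (ger0_norm (ltW rb0)) lerD//.
  by rewrite ler_wpM2l// ltW.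
rewrite (ger0_norm (a_ge0 s s0)) ler_pM// ?a_ge0// ?a_le// ger0_norm ?sqr_ge0//.
by rewrite [N ^+ 2]expr2 ler_pM.
Qed.

Let m_le_lin (S T C : R) : 0 <= S -> S <= T -> (forall s, S < s <= T -> m s <= C) ->
  m T <= m S + rb * C * (T - S).
Proof.
move=> S0 ST mC; rewrite -lerBlDl; apply: (le_trans (m_le S T S0 ST)).
rewrite -Rintegral_itv_cst//; apply: le_Rintegral => //.
- exact: integrable_drift.
- by apply: continuous_itv_integrable; exact: cst_continuous.
- move=> s; rewrite /= in_itv/= => /andP[Ss sT].
  have s0 : 0 <= s by rewrite (le_trans S0)// ltW.
  have h1 : rb * m s <= rb * C by rewrite ler_wpM2l ?(ltW rb0)// mC// Ss.
  have h2 : 0 <= a s * m s ^+ 2 by apply: mulr_ge0; [exact: a_ge0|exact: sqr_ge0].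
  by move: h1 h2; lra.
Qed.

Let h := (2 * rb)^-1.

(** Gronwall without exponentials: since rb h = 1 / 2, the supremum of m over [S, S + h], finite
    because m <= N, is at most m S plus half of itself. *)
Let m_double (S T : R) : 0 <= S -> S <= T -> T <= S + h -> m T <= 2 * m S.
Proof.
move=> S0 ST TSh; pose A := [set m t | t in `[S, S + h]].
have h0 : 0 < h by rewrite invr_gt0 mulr_gt0.
have supA : has_sup A.
  split; first by exists (m S); exists S => //=; rewrite in_itv/= lexx lerDl ltW.
  by exists N => _ [t _ <-]; have /andP[] := mN t.
have mA t : S <= t -> t <= S + h -> m t <= sup A.
  by move=> St tS; apply: sup_upper_bound => //; exists t => //=; rewrite in_itv/= St.
suff supm : sup A <= m S + sup A / 2.
  by apply: (le_trans (mA T ST TSh)); move: supm; lra.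
apply: ge_sup; first by case: supA.
move=> y [t + <-]; rewrite /= in_itv/= => /andP[St tS].
apply: (le_trans (m_le_lin S t (sup A) S0 St _)).
  by move=> s /andP[Ss st]; apply: mA; [exact: ltW|exact: le_trans tS].
have supA0 : 0 <= sup A.
  by apply: le_trans (mA S (lexx _) _); [have /andP[] := mN S|rewrite lerDl ltW].
rewrite lerD2l mulrAC -[leRHS]mulrC ler_wpM2r//.
have : rb * (t - S) <= rb * h by rewrite ler_wpM2l ?(ltW rb0)// lerBlDl.
by rewrite /h invfM mulrCA divff ?mulr1// gt_eqF.
Qed.

Let m_growth (k : nat) (S T : R) : 0 <= S -> S <= T -> T <= S + h * k%:R -> m T <= 2 ^+ k * m S.
Proof.
elim: k S => [|k IH] S S0 ST Th.
  have -> : T = S by apply/eqP; rewrite eq_le ST andbT; move: Th; rewrite mulr0 addr0.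
  by rewrite expr0 mul1r.
have h0 : 0 < h by rewrite invr_gt0 mulr_gt0.
have [TSh|STh] := leP T (S + h).
  apply: (le_trans (m_double S T S0 ST TSh)); rewrite exprS -mulrA ler_wpM2l//.
  by rewrite ler_peMl ?exprn_ege1 ?ler1n//; have /andP[] := mN S.
have Sh0 : 0 <= S + h by rewrite addr_ge0// ltW.
apply: (le_trans (IH (S + h) Sh0 (ltW STh) _)).
  by move: Th; rewrite -natr1 mulrDr mulr1; lra.
rewrite exprSr -mulrA ler_wpM2l ?exprn_ge0//.
by apply: m_double => //; rewrite lerDl ltW.
Qed.

Variables (gamma delta t0 : R) (k : nat).
Hypotheses (gamma0 : 0 < gamma) (delta0 : 0 < delta) (gammak : gamma <= h * k%:R).
Hypothesis delta_le : forall t : R, t0 <= t -> delta <= \int[mu]_(s in `]t, t + gamma]) a s.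

Let C : R := 2 ^+ k.
(** The level from which the loss (m t / C)^2 delta over a window ending at t is at least 2 (1 + rb
    gamma C) m t. It does not involve N. *)
Definition logistic_bound : R := 2 * C ^+ 2 * (1 + rb * gamma * C) / delta.

Let C1 : 1 <= C. Proof. by rewrite exprn_ege1// ler1n. Qed.

(** On the window m is at most C m s in the growth term and at least m t / C in the loss term. With
    e = 1 + rb gamma C this gives m t + 2 e m t <= e m s, hence the halving. *)
Let window (s : R) : 0 <= s -> t0 <= s -> logistic_bound <= m (s + gamma) ->
  2 * m (s + gamma) <= m s.
Proof.
move=> s0 t0s Kb; set t := s + gamma.
have st : s <= t by rewrite lerDl ltW.
have /andP[mt0 _] := mN t.
have up u : s < u <= t -> m u <= C * m s.
  by move=> /andP[su ut]; apply: m_growth => //; [exact: ltW|rewrite (le_trans ut)// lerD2l].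
have down u : s < u <= t -> m t / C <= m u.
  move=> /andP[su ut]; rewrite ler_pdivrMr ?(lt_le_trans ltr01)// mulrC.
  apply: m_growth => //; first by rewrite (le_trans s0)// ltW.
  by rewrite (le_trans (_ : t <= s + h * k%:R)) ?lerD2l// lerD2r ltW.
pose q := (m t / C) ^+ 2.
have ints : mu.-integrable `]s, t] (EFin \o (fun u => rb * (C * m s) + (- q) * a u)).
  apply: integrable_EFinD => //; first exact: (continuous_itv_integrable (cst _) _ _ (@cst_continuous _ _ _)).
  by apply: integrable_EFinZ => //; exact: integrable_a.
have main : m t - m s <= rb * (C * m s) * gamma - q * delta.
  apply: (le_trans (m_le s t s0 st)).
  apply: (@le_trans _ _ (\int[mu]_(u in `]s, t]) (rb * (C * m s) + (- q) * a u))).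
    apply: le_Rintegral => //; first exact: integrable_drift.
    move=> u; rewrite /= in_itv/= => sut; have u0 : 0 <= u.
      by case/andP: sut => su _; rewrite (le_trans s0)// ltW.
    rewrite mulNr lerB//; first by rewrite ler_wpM2l ?(ltW rb0)// up.
    rewrite mulrC ler_wpM2l ?a_ge0// lerXn2r ?nnegrE//.
    - by rewrite divr_ge0// (le_trans ler01).
    - by have /andP[] := mN u.
    - exact: down.
  rewrite RintegralD//; last 2 first.
  - exact: (continuous_itv_integrable (cst _) _ _ (@cst_continuous _ _ _)).
  - by apply: integrable_EFinZ => //; exact: integrable_a.
  rewrite Rintegral_itv_cst// RintegralZl//; last exact: integrable_a.
  rewrite (_ : t - s = gamma) ?mulNr; last by rewrite /t addrC addKr.
  by rewrite lerB// ler_wpM2l ?sqr_ge0// delta_le.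
have Cp : 0 < C by exact: lt_le_trans C1.
pose e := 1 + rb * gamma * C.
have e0 : 0 < e by rewrite ltr_pwDl// !mulr_ge0// ltW.
have qK : 2 * e * m t <= q * delta.
  have : logistic_bound * (m t * delta / C ^+ 2) <= m t * (m t * delta / C ^+ 2).
    by apply: ler_wpM2r => //; rewrite !mulr_ge0 ?invr_ge0 ?exprn_ge0// ltW.
  have -> : logistic_bound * (m t * delta / C ^+ 2) = 2 * e * m t.
    by rewrite /logistic_bound -/C -/e; field; rewrite !gt_eqF.
  by have -> : m t * (m t * delta / C ^+ 2) = q * delta by rewrite /q; field; rewrite gt_eqF.
rewrite -(ler_pM2l e0); move: main qK mt0; rewrite /e; nra.
Qed.

(** If m t exceeded the bound K, going back j windows would give m >= 2^j K, which is more than N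
    for the chosen j. Starting j windows after max 0 t0 keeps all of them in the range of the
    hypotheses; only this starting time depends on N. *)
Lemma logistic_inequality_bound : exists t1, forall t, t1 <= t -> m t <= logistic_bound.
Proof.
have Cp : 0 < C by exact: lt_le_trans C1.
have K0 : 0 < logistic_bound.
  by rewrite divr_gt0// !mulr_gt0 ?exprn_gt0// ltr_pwDl// !mulr_ge0// ltW.
have back j t : Num.max 0 t0 + gamma * j%:R <= t -> logistic_bound <= m t ->
    2 ^+ j * logistic_bound <= m (t - gamma * j%:R).
  elim: j => [|j IH] tj Kt; first by rewrite mulr0 subr0 mul1r.
  have tj' : Num.max 0 t0 + gamma * j%:R <= t.
    by apply: le_trans tj; rewrite lerD2l ler_wpM2l ?ler_nat// ltW.
  have IHj := IH tj' Kt.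
  have : Num.max 0 t0 <= t - gamma * j.+1%:R by rewrite lerBrDr.
  rewrite ge_max => /andP[s0 t0s].
  have E : t - gamma * j.+1%:R + gamma = t - gamma * j%:R by rewrite -natr1; ring.
  have := window _ s0 t0s; rewrite E => w.
  rewrite exprS -mulrA; apply: le_trans (w _).
    by rewrite ler_wpM2l.
  by apply: le_trans IHj; rewrite ler_peMl ?(ltW K0)// exprn_ege1// ler1n.
pose j := Num.bound (N / logistic_bound).
have Nj : N < 2 ^+ j * logistic_bound.
  rewrite -ltr_pdivrMr//; apply: (lt_le_trans (archi_boundP _)).
    by rewrite divr_ge0// ltW.
  by rewrite -natrX ler_nat ltnW// ltn_expl.
exists (Num.max 0 t0 + gamma * j%:R) => t tj; rewrite leNgt; apply/negP => /ltW Kt.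
have := back j t tj Kt; have /andP[_ h2] := mN (t - gamma * j%:R).
by move=> /le_trans /(_ h2); rewrite leNgt Nj.
Qed.

End logistic_inequality.

(** * The stochastic logistic equation *)

Section saturation.
Context {R : realType}.
Variable N : R.
Hypothesis N0 : 0 < N.

(* The absolute values only make both functions total and continuous: they are
   used on positive arguments. *)
Definition saturation (y : R) : R := N * y / (N + `|y|).
Definition saturation' (y : R) : R := N ^+ 2 / (N + `|y|) ^+ 2.

Let Ny_gt0 (y : R) : 0 < N + `|y|. Proof. by rewrite ltr_pwDl. Qed.

Let Ny_neq0 (y : R) : N + `|y| != 0. Proof. by rewrite gt_eqF. Qed.

Lemma saturation_le (y : R) : `|saturation y| <= N.
Proof.
rewrite normrM normrM normfV (ger0_norm (ltW N0)) (ger0_norm (ltW (Ny_gt0 y))).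
by rewrite ler_pdivrMr// ler_wpM2l ?ltW// ltr_pwDl.
Qed.

Lemma saturation'_le1 (y : R) : `|saturation' y| <= 1.
Proof.
rewrite ger0_norm; last by rewrite divr_ge0 ?sqr_ge0.
rewrite ler_pdivrMr ?exprn_gt0// mul1r lerXn2r ?nnegrE ?(ltW N0)//; first exact: ltW.
by rewrite lerDl.
Qed.

Let continuous_Ny : continuous (fun y : R => N + `|y|).
Proof. by move=> y; apply: cvgD; [exact: cvg_cst|exact: norm_continuous]. Qed.

Lemma continuous_saturation : continuous saturation.
Proof.
move=> y; apply: cvgM; first by apply: cvgM; [exact: cvg_cst|exact: cvg_id].
by apply: cvgV => //; exact: continuous_Ny.
Qed.

Lemma continuous_saturation' : continuous saturation'.
Proof.
move=> y; apply: cvgM; first exact: cvg_cst.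
apply: cvgV; first by rewrite expf_neq0.
by apply: (@cvg_comp _ _ _ (fun y => N + `|y|) (fun x => x ^+ 2) _ (nbhs (N + `|y|)));
  [exact: continuous_Ny|exact: exprn_continuous].
Qed.

Lemma saturation_concave (y z : R) : 0 < y -> 0 < z ->
  saturation z - saturation y <= saturation' y * (z - y).
Proof.
move=> y0 z0; rewrite /saturation /saturation' !gtr0_norm// -subr_ge0.
have hy : N + y != 0 by rewrite gt_eqF// addr_gt0.
have hz : N + z != 0 by rewrite gt_eqF// addr_gt0.
have -> : N ^+ 2 / (N + y) ^+ 2 * (z - y) - (N * z / (N + z) - N * y / (N + y)) =
    (N * (z - y) / (N + y)) ^+ 2 / (N + z) by field; rewrite hy hz.
by rewrite divr_ge0 ?sqr_ge0// addr_ge0// ltW.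
Qed.

Lemma saturation'M (y : R) : 0 < y -> saturation' y * y = saturation y - saturation y ^+ 2 / N.
Proof.
move=> y0; rewrite /saturation /saturation' !gtr0_norm//.
by field; rewrite !gt_eqF// addr_gt0.
Qed.

Lemma saturation'M2 (y : R) : 0 < y -> saturation' y * y ^+ 2 = saturation y ^+ 2.
Proof.
move=> y0; rewrite /saturation /saturation' !gtr0_norm//.
by field; rewrite gt_eqF// addr_gt0.
Qed.

Lemma saturation_ge0 (y : R) : 0 <= y -> 0 <= saturation y.
Proof. by move=> y0; rewrite divr_ge0// ?mulr_ge0// ltW. Qed.

Lemma saturation'M_bounds (y : R) : 0 < y -> 0 <= saturation' y * y <= saturation y.
Proof.
move=> y0; apply/andP; split; first by rewrite mulr_ge0 ?(ltW y0)// divr_ge0 ?sqr_ge0.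
by rewrite saturation'M// gerBl divr_ge0 ?sqr_ge0// ltW.
Qed.

(** Converts the tail event x > N into an event for V, at the price of the factor 2 in 2 K / N. *)
Lemma saturation_gt_half (y : R) : N < y -> N / 2 <= saturation y.
Proof.
move=> Ny; have y0 : 0 < y by exact: lt_trans Ny.
rewrite /saturation gtr0_norm// ler_pdivlMr ?addr_gt0//.
have : N * N < N * y by rewrite ltr_pM2l.
by lra.
Qed.

End saturation.

(** * Null sets, completeness and modification of paths *)

Section completeness.
Context {d : measure_display} {Omega : measurableType d} {R : realType}.
Variable P : probability Omega R.
Hypothesis hP : measure_is_complete P.

(** Completeness makes every subset of Z measurable. The lemma moves probabilities between events
    for a process and the same events for its modification off Z. *)
Lemma complete_measure_eq (A E Z : set Omega) : measurable A -> P.-negligible Z ->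
  A `\` Z = E `\` Z -> measurable E /\ P E = P A.
Proof.
move=> mA nZ AE; have mZ : measurable Z by exact: hP.
have PZ : P Z = 0%E by apply/negligibleP.
have mEZ : measurable (E `&` Z) by apply: hP; apply: negligibleS nZ; exact: subIsetr.
have mAZ : measurable (A `&` Z) by exact: measurableI.
have mD : measurable (A `\` Z) by exact: measurableD.
have EE : E = (A `\` Z) `|` (E `&` Z) by rewrite AE setUC setUIDK.
have P0 (U : set Omega) : measurable (U `&` Z) -> P (U `&` Z) = 0%E.
  move=> mU; apply/eqP; rewrite eq_le measure_ge0 andbT -PZ le_measure ?inE//.
have PD (U : set Omega) : measurable (U `&` Z) -> P ((A `\` Z) `|` (U `&` Z)) = P (A `\` Z).
  move=> mU; rewrite measureU//=; first by rewrite (P0 U mU) adde0.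
  by rewrite setDE -setIA [~` Z `&` _]setICA setICl !setI0.
split; first by rewrite EE; exact: measurableU.
by rewrite {1}EE PD// -(PD A)// setUC setUIDK.
Qed.

End completeness.

Section modification.
Context {d : measure_display} {Omega : measurableType d} {R : realType}.
Variables (P : probability Omega R) (F : R -> set (set Omega)).
Hypotheses (hP : measure_is_complete P) (hF : filtration F).
Variable B : R -> Omega -> R.
Local Notation mu := (@lebesgue_measure R).

(** Paths and coefficients are extended to negative times by their value at 0, so that continuity on
    the half-line becomes continuity on R. *)
Lemma continuous_max0 (f : R -> R) : {within `[0, +oo[, continuous f} ->
  continuous (fun t : R => f (Num.max t 0)).
Proof.
move=> /subspace_continuousP cf t.
have A0 (s : R) : `[0, +oo[%classic (Num.max s 0 : R) by rewrite /= in_itv/= le_max lexx orbT.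
have cm : Num.max s 0 @[s --> t] --> (Num.max t 0 : R).
  have E (s : R) : Num.max s 0 = (s + `|s|) / 2 :> R.
    case: (leP s 0) => s0; [rewrite ler0_norm//|rewrite gtr0_norm//]; lra.
  rewrite E; under eq_fun do rewrite E.
  apply: cvgMl; apply: cvgD; [exact: cvg_id|exact: norm_continuous].
apply: (@cvg_comp _ _ _ (fun s => Num.max s 0) f _ (within `[0, +oo[ (nbhs (Num.max t 0)))).
  move=> U hU; have h : \forall s \near t, `[0, +oo[%classic (Num.max s 0) -> U (Num.max s 0).
    exact: (cm _ hU).
  by apply: filterS h => s; apply; exact: A0.
exact: (cf _ (A0 t)).
Qed.

(** The same simple processes are kept; only the events on the energy error change, and only inside
    Z. *)
Lemma ito_integral_congr (T : R) (phi phi' : R -> Omega -> R) (I : Omega -> R) (Z : set Omega) :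
  P.-negligible Z -> (forall s w, 0 <= s -> ~ Z w -> phi s w = phi' s w) ->
  (forall f : simple_process F T, measurable_fun setT (fun w =>
    \int[mu]_(s in `[0%R, T]) ((simple_fun f s w - phi' s w) ^+ 2)%:E)%E) ->
  ito_integral P F B T phi I -> ito_integral P F B T phi' I.
Proof.
move=> nZ phiE mint [f [h1 h2]]; exists f; split => // e e0.
apply: cvg_trans (h1 e e0); apply: near_eq_cvg; apply: nearW => n.
apply: (complete_measure_eq P hP _ _ Z _ nZ _).2.
  rewrite -[X in measurable X]setTI; exact: emeasurable_fun_c_infty.
have intE w : ~ Z w -> (\int[mu]_(s in `[0%R, T]) ((simple_fun (f n) s w - phi' s w) ^+ 2)%:E =
    \int[mu]_(s in `[0%R, T]) ((simple_fun (f n) s w - phi s w) ^+ 2)%:E)%E.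
  move=> Zw; apply: eq_integral => s; rewrite inE/= in_itv/= => /andP[s0 _].
  by rewrite phiE.
by apply/seteqP; split => w [/= h Zw]; split => //; move: h; rewrite intE.
Qed.

Lemma measurable_simple_energy (T : R) (f : simple_process F T) (phi : R -> Omega -> R) :
  0 <= T -> measurable_fun setT (fun z : R * Omega => phi z.1 z.2) ->
  measurable_fun setT (fun w =>
    \int[mu]_(s in `[0%R, T]) ((simple_fun f s w - phi s w) ^+ 2)%:E)%E.
Proof.
move=> T0 mphi; apply: measurable_fun_int => //; last by move=> s w; rewrite lee_fin sqr_ge0.
apply/measurable_EFinP; apply: measurable_funX; apply: measurable_funB => //.
apply: measurable_sum => -[i fi] /=; apply: measurable_funM.
  apply: measurableT_comp => //.
  apply: (sub_measurable_fun F hF (sp_time f i)); last exact: sp_val_measurable.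
  by rewrite -(sp_time_first f); apply: sp_time_homo => //; exact: ltnW.
by apply: measurableT_comp.
Qed.

End modification.

Lemma bounded_halfline {R : realType} (f : R -> R) : [bounded f t | t in `[0, +oo[] ->
  exists2 C : R, 0 < C & forall t, 0 <= t -> `|f t| <= C.
Proof.
move=> [M [_ hM]]; exists (`|M| + 1) => [|t t0]; first by rewrite ltr_pwDr.
by apply: (hM (`|M| + 1)); rewrite ?(le_lt_trans (ler_norm M)) ?ltrDl//= in_itv/= t0.
Qed.

Section logistic_sde.
Context {d : measure_display} {Omega : measurableType d} {R : realType}.
Variables (P : probability Omega R) (F : R -> set (set Omega)).
Hypotheses (hP : measure_is_complete P) (hF : filtration F) (hFu : usual_conditions P F).
Variable B : R -> Omega -> R.
Hypothesis hB : brownian_motion P F B.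
Variables r a sigma : R -> R.
Hypotheses (hrc : {within `[0, +oo[, continuous r}) (hac : {within `[0, +oo[, continuous a})
  (hsc : {within `[0, +oo[, continuous sigma}).
Local Notation mu := (@lebesgue_measure R).

Let ext (f : R -> R) : R -> R := fun t => f (Num.max t 0).
Local Notation r' := (ext r).
Local Notation a' := (ext a).
Local Notation sigma' := (ext sigma).

Let extE (f : R -> R) (t : R) : 0 <= t -> ext f t = f t.
Proof. by move=> t0; rewrite /ext max_l. Qed.

(* Off a null set, which lies in F 0, the solution is replaced by the constant 1,
   so that all paths become continuous and positive. *)
Lemma solution_modification (x : R -> Omega -> R) :
  positive_solution P F B (fun t y => y * (r t - a t * y)) (fun t y => y * sigma t) x ->
  exists (X : R -> Omega -> R) (Z : set Omega),
  [/\ P.-negligible Z, forall t w, 0 <= t -> ~ Z w -> X t w = x t w,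
      adapted F X,
      (forall w, continuous (X ^~ w)) /\ (forall s, measurable_fun setT (X s)) /\
      (forall s w, 0 < X s w) &
      forall s t, 0 <= s -> s <= t -> exists J : Omega -> R,
        ito_increment P F B s t (fun u w => X u w * sigma' u) J /\
        {ae P, forall w, X t w - X s w =
          \int[mu]_(u in `]s, t]) (X u w * (r' u - a' u * X u w)) + J w}].
Proof.
move=> [[adx cx _ _ eqx] _ posx].
pose G := [set w | {within `[0, +oo[, continuous (x ^~ w)} /\ forall t : R, 0 <= t -> 0 < x t w].
have nZ : P.-negligible (~` G).
  have : {ae P, forall w, G w} by apply: filterS2 cx posx => w h1 h2; split.
  by [].
pose X (t : R) w : R := \1_G w * x (Num.max t 0) w + \1_(~` G) w.
have XG t w : G w -> X t w = x (Num.max t 0) w.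
  by move=> Gw; rewrite /X !indicE mem_set// mul1r memNset ?addr0// => /(_ Gw).
have XZ t w : ~ G w -> X t w = 1.
  by move=> Gw; rewrite /X !indicE memNset// mul0r mem_set// add0r.
have FZ (t : R) : 0 <= t -> F t (~` G).
  move=> t0; apply: (filtration_nondecreasing hF (lexx 0) t0).
  exact: (usual_null_sets hFu).
have mxF (t u : R) : 0 <= u -> Num.max t 0 <= u -> sub_measurable (F u) (X t).
  move=> u0 tu; have sF := filtration_sigma_algebra hF u0.
  have FGC := FZ u u0.
  have m1 : sub_measurable (F u) (\1_(~` G) : Omega -> R).
    apply/(sub_measurableP _ sF); apply: measurable_indic.
    by rewrite /measurable/= sigma_algebra_id.
  have m2 : sub_measurable (F u) (\1_G : Omega -> R).
    have -> : \1_G = (fun y : R => 1 - y) \o (\1_(~` G) : Omega -> R).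
      apply/funext => w /=; rewrite !indicE.
      have [Gw|Gw] := pselect (G w).
        by rewrite mem_set// memNset ?subr0// => /(_ Gw).
      by rewrite memNset// mem_set// subrr.
    apply: sub_measurable_comp => //; exact: measurable_funB.
  apply: sub_measurableD => //; apply: sub_measurableM => //.
  have max0 : 0 <= Num.max t 0 by rewrite le_max lexx orbT.
  by apply: (sub_measurable_le F hF (Num.max t 0)) => //; exact: adx.
have cX w : continuous (X ^~ w).
  have [Gw|Gw] := pselect (G w).
    rewrite (_ : X ^~ w = fun t => x (Num.max t 0) w); last by apply/funext => t; exact: XG.
    by case: Gw => cw _; exact: (continuous_max0 (x ^~ w) cw).
  rewrite (_ : X ^~ w = cst 1); last by apply/funext => t; exact: XZ.
  exact: cst_continuous.
have mX s : measurable_fun setT (X s).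
  apply: (sub_measurable_fun F hF (Num.max s 0)); first by rewrite le_max lexx orbT.
  by apply: mxF => //; rewrite le_max lexx orbT.
have cr := continuous_max0 r hrc; have ca := continuous_max0 a hac.
have cs := continuous_max0 sigma hsc.
exists X, (~` G); split => //.
- by move=> t w t0 /contrapT Gw; rewrite XG// max_l.
- by move=> t t0; apply: mxF; rewrite // max_l.
- split=> //; split=> // s w; have [Gw|Gw] := pselect (G w); last by rewrite XZ.
  by rewrite XG//; case: Gw => _; apply; rewrite le_max lexx orbT.
have cg w : continuous (fun u => X u w * sigma' u) by move=> u; apply: cvgM; [exact: cX|exact: cs].
have cb w : continuous (fun u => X u w * (r' u - a' u * X u w)).
  move=> u; apply: cvgM; first exact: cX.
  by apply: cvgB; [exact: cr|apply: cvgM; [exact: ca|exact: cX]].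
have jg : measurable_fun setT (fun z : R * Omega => X z.1 z.2 * sigma' z.1).
  apply: (joint_measurable (fun u w => X u w * sigma' u)) => // s.
  exact: measurable_funM.
have inc0 (t : R) : 0 <= t -> exists I : Omega -> R,
    ito_increment P F B 0 t (fun u w => X u w * sigma' u) I /\
    {ae P, forall w, X t w = X 0 w + \int[mu]_(u in `]0, t]) (X u w * (r' u - a' u * X u w)) + I w}.
  move=> t0; have [I [mI hI eqI]] := eqx t t0; exists I; split.
    apply: (ito_integral_increment0 P F hF B hB) => //.
    + move=> f; exact: (measurable_simple_energy F hF).
    + by move=> w; apply: measurable_funTS; apply: continuous_measurable_fun; exact: cg.
    + apply: (ito_integral_congr P F hP B t _ _ I _ nZ _ _ hI).
        by move=> s w s0 /contrapT Gw; rewrite XG// max_l// extE.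
      by move=> f; exact: (measurable_simple_energy F hF).
  have aeG : {ae P, forall w, G w} by [].
  apply: filterS2 aeG eqI => w Gw; rewrite !XG// !max_l// => ->; congr (_ + _ + _).
  rewrite Rintegral_itv_obnd_cbnd//; last exact: (continuous_itv_integrable _ _ _ (cb w)).
  apply: eq_Rintegral => s; rewrite inE/= in_itv/= => /andP[s0 _].
  by rewrite XG// max_l// !extE.
move=> s t s0 st; have t0 := le_trans s0 st.
have [I [hI eI]] := inc0 t t0; have [I' [hI' eI']] := inc0 s s0.
exists (fun w => I w - I' w); split.
  apply: (ito_increment_sub P F hF B hB) => // w.
  by apply: measurable_funTS; apply: continuous_measurable_fun; exact: cg.
apply: filterS2 eI eI' => w -> ->.
rewrite (Rintegral_itv_cat _ 0 s t)//; last exact: (continuous_itv_integrable _ _ _ (cb w)).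
ring.
Qed.

Variables rb ab sb : R.
Hypotheses (rb0 : 0 < rb) (hrb : forall t : R, 0 <= t -> `|r t| <= rb).
Hypotheses (ha0 : forall t : R, 0 <= t -> 0 <= a t) (hab : forall t : R, 0 <= t -> `|a t| <= ab).
Hypothesis hsb : forall t : R, 0 <= t -> `|sigma t| <= sb.

Let max0_ge0 (t : R) : 0 <= Num.max t 0. Proof. by rewrite le_max lexx orbT. Qed.

(* Jensen's inequality E[V^2] >= E[V]^2 closes the inequality satisfied by the
   mean of V = saturation N (X t). *)
Lemma saturated_mean_inequality (X : R -> Omega -> R) (N : R) : 0 < N ->
  adapted F X -> (forall w, continuous (X ^~ w)) -> (forall s, measurable_fun setT (X s)) ->
  (forall s w, 0 < X s w) ->
  (forall s t, 0 <= s -> s <= t -> exists J : Omega -> R,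
    ito_increment P F B s t (fun u w => X u w * sigma' u) J /\
    {ae P, forall w, X t w - X s w =
      \int[mu]_(u in `]s, t]) (X u w * (r' u - a' u * X u w)) + J w}) ->
  let m t := \int[P]_w saturation N (X t w) in
  [/\ forall t, 0 <= m t <= N,
      forall S T : R, measurable_fun `]S, T] m &
      forall S T : R, 0 <= S -> S <= T ->
        m T - m S <= \int[mu]_(s in `]S, T]) (rb * m s - a' s * m s ^+ 2)].
Proof.
move=> N0 adX cX mX X0 inc m.
pose V := saturation N; pose V' := saturation' N.
have cr := continuous_max0 r hrc; have ca := continuous_max0 a hac.
have cs := continuous_max0 sigma hsc.
have mV : measurable_fun setT V by apply: continuous_measurable_fun; exact: continuous_saturation.
have V01 s w : 0 <= V (X s w) <= N.
  rewrite saturation_ge0 ?(ltW (X0 _ _))//=.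
  by apply: le_trans (ler_norm _) _; exact: saturation_le.
have iV t : P.-integrable setT (EFin \o (fun w => V (X t w))).
  apply: (bounded_integrable P _ N) => //; first exact: measurableT_comp.
  by move=> w _; exact: saturation_le.
have iV2 t : P.-integrable setT (EFin \o (fun w => V (X t w) ^+ 2)).
  apply: (bounded_integrable P _ (N ^+ 2)) => //.
    by apply: measurable_funX; exact: measurableT_comp.
  move=> w _; rewrite normrX lerXn2r ?nnegrE// ?(ltW N0)//; exact: saturation_le.
have m01 t : 0 <= m t <= N.
  apply/andP; split; first by apply: Rintegral_ge0 => w _; have /andP[] := V01 t w.
  have -> : N = \int[P]_w (cst N w) by rewrite Rintegral_cst//= probability_setT/= mulr1.
  apply: le_Rintegral => //; first exact: finite_measure_integrable_cst.
  by move=> w _; have /andP[] := V01 t w.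
have jX : measurable_fun setT (fun z : R * Omega => X z.1 z.2) by exact: joint_measurable.
have jVX : measurable_fun setT (fun z : R * Omega => V (X z.1 z.2)) by exact: measurableT_comp.
have mm (S T : R) : measurable_fun `]S, T] m.
  have [_ h _] := bounded_fubini P S T N (fun s w => V (X s w)) jVX
    (fun s w _ => saturation_le N N0 (X s w)).
  exact: h.
split=> // S T S0; rewrite le_eqVlt => /predU1P[->|ST].
  by rewrite set_itvoc0 Rintegral_set0 subrr.
pose b u w := X u w * (r' u - a' u * X u w).
pose g u w := X u w * sigma' u.
have cb w : continuous (b ^~ w).
  move=> u; apply: cvgM; first exact: cX.
  by apply: cvgB; [exact: cr|apply: cvgM; [exact: ca|exact: cX]].
have mb s : measurable_fun setT (b s).
  by apply: measurable_funM => //; apply: measurable_funB => //; exact: measurable_funM.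
have cg w : continuous (g ^~ w) by move=> u; apply: cvgM; [exact: cX|exact: cs].
have mg s : measurable_fun setT (g s) by exact: measurable_funM.
have a'0 s : 0 <= a' s by exact: ha0.
have a'b s : a' s <= ab by apply: le_trans (ler_norm _) _; exact: hab.
have ab0 : 0 <= ab by exact: le_trans (a'b 0).
have r'b s : `|r' s| <= rb by exact: hrb.
(* The identity y^2 V'(y) = V(y)^2 makes the quadratic loss an exact function of V, although X^2
   itself is unbounded. *)
have driftE s w : V' (X s w) * b s w = r' s * (V' (X s w) * X s w) - a' s * V (X s w) ^+ 2.
  by rewrite /V -saturation'M2// /b /V'; ring.
have drift_up s w : V' (X s w) * b s w <= rb * V (X s w) - a' s * V (X s w) ^+ 2.
  rewrite driftE lerB//; have /andP[h1 h2] := saturation'M_bounds N N0 _ (X0 s w).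
  apply: (@le_trans _ _ (rb * (V' (X s w) * X s w))).
    by rewrite ler_wpM2r// (le_trans (ler_norm _)).
  by rewrite ler_wpM2l ?(ltW rb0).
have nM (p u C D : R) : `|p| <= C -> `|u| <= D -> `|p * u| <= C * D.
  by move=> pC uD; rewrite normrM ler_pM.
have nV'X s w : `|V' (X s w) * X s w| <= N.
  have /andP[h1 h2] := saturation'M_bounds N N0 _ (X0 s w).
  have /andP[_ h4] := V01 s w.
  by rewrite (ger0_norm h1); exact: le_trans h4.
have na' s : `|a' s| <= ab by rewrite ger0_norm.
have nsq u : 0 <= u <= N -> `|u ^+ 2| <= N ^+ 2.
  by move=> /andP[u0 uN]; rewrite ger0_norm ?sqr_ge0// lerXn2r// nnegrE// ltW.
have drift_norm s w : `|V' (X s w) * b s w| <= rb * N + ab * N ^+ 2.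
  rewrite driftE; apply: (le_trans (ler_normB _ _)); apply: lerD; first exact: nM.
  by apply: nM => //; exact: nsq.
have diff_norm s w : (V' (X s w) * g s w) ^+ 2 <= (N * sb) ^+ 2.
  have sb0 : 0 <= sb by exact: le_trans (hsb 0 (lexx 0)).
  rewrite -real_normK ?num_real// lerXn2r ?nnegrE// ?mulr_ge0 ?(ltW N0)//.
  rewrite /g mulrA; apply: nM => //; exact: hsb.
have dyn := concave_dynkin P F hF B hB X b g V V' N (rb * N + ab * N ^+ 2) ((N * sb) ^+ 2)
  adX cX mX cb mb cg mg X0 (saturation_concave N N0) mV (saturation_le N N0)
  (continuous_saturation' N N0) (saturation'_le1 N N0) drift_norm diff_norm inc S T S0 ST.
have jD : measurable_fun setT (fun z : R * Omega => V' (X z.1 z.2) * b z.1 z.2).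
  apply: measurable_funM; last exact: joint_measurable.
  apply: measurableT_comp => //; apply: continuous_measurable_fun.
  exact: continuous_saturation'.
have [_ mED fubini] := bounded_fubini P S T _ _ jD (fun s w _ => drift_norm s w).
apply: (le_trans dyn); rewrite fubini; apply: le_Rintegral => //.
- apply: (bounded_itv_integrable _ _ _ (rb * N + ab * N ^+ 2)) => // s _.
  have iD : P.-integrable setT (EFin \o (fun w => V' (X s w) * b s w)).
    apply: (bounded_integrable P _ (rb * N + ab * N ^+ 2)) => //.
    exact: (measurable_fun_pair2 s jD).
  apply: (le_trans (le_normr_Rintegral measurableT iD)).
  have -> : rb * N + ab * N ^+ 2 = \int[P]_w (cst (rb * N + ab * N ^+ 2) w).
    by rewrite Rintegral_cst//= probability_setT/= mulr1.
  apply: le_Rintegral => //; first exact: (integrable_norm iD).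
  exact: finite_measure_integrable_cst.
- apply: (bounded_itv_integrable _ _ _ (rb * N + ab * N ^+ 2)).
    apply: measurable_funB; first by apply: measurable_funM => //; exact: mm.
    apply: measurable_funM; last by apply: measurable_funX; exact: mm.
    by apply: measurable_funTS; apply: continuous_measurable_fun.
  move=> s _; have /andP[h1 h2] := m01 s.
  apply: (le_trans (ler_normB _ _)); apply: lerD; apply: nM => //.
  - by rewrite ger0_norm// ltW.
  - by rewrite ger0_norm.
  - exact: nsq.
- move=> s _.
  have iD : P.-integrable setT (EFin \o (fun w => V' (X s w) * b s w)).
    apply: (bounded_integrable P _ (rb * N + ab * N ^+ 2)) => //.
    exact: (measurable_fun_pair2 s jD).
  (* Jensen through the tangent line: V^2 >= 2 m V - m^2, multiplied by a >= 0 and integrated with E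
     V = m. *)
  pose q := - a' s * (2 * m s).
  apply: (@le_trans _ _ (\int[P]_w ((rb + q) * V (X s w) + a' s * m s ^+ 2))).
    apply: le_Rintegral => //.
      apply: integrable_EFinD => //; first exact: integrable_EFinZ.
      exact: finite_measure_integrable_cst.
    move=> w _; apply: (le_trans (drift_up s w)).
    have : 0 <= a' s * (V (X s w) - m s) ^+ 2 by rewrite mulr_ge0 ?sqr_ge0.
    by rewrite /q; lra.
  rewrite RintegralD//; last 2 first.
  - exact: integrable_EFinZ.
  - exact: finite_measure_integrable_cst.
  rewrite RintegralZl// Rintegral_cst//= probability_setT/= mulr1 -/(m s) /q.
  by rewrite le_eqVlt; apply/orP; left; apply/eqP; ring.
Qed.

Variables gamma delta t0 : R.
Hypotheses (gamma0 : 0 < gamma) (delta0 : 0 < delta).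
Hypothesis delta_le : forall t : R, t0 <= t ->
  (delta%:E <= \int[mu]_(s in `[t, (t + gamma)%R]) (a s)%:E)%E.

(** The number of doubling steps of length 1 / (2 rb) needed to cover a window of length gamma. *)
Let k := Num.bound (gamma * (2 * rb)).
Let K := logistic_bound rb gamma delta k.

Lemma solution_tail_bound (x : R -> Omega -> R) (N : R) : 0 < N ->
  positive_solution P F B (fun t y => y * (r t - a t * y)) (fun t y => y * sigma t) x ->
  exists t1 : R, forall t, t1 <= t -> (P [set w | (N < x t w)%R] <= (2 * K / N)%:E)%E.
Proof.
move=> N0 solx.
have [X [Z [nZ XE adX [cX [mX X0]] inc]]] := solution_modification x solx.
have [] := saturated_mean_inequality X N N0 adX cX mX X0 inc.
set m := fun t => _ => m01 mm m_le.
have ca := continuous_max0 a hac.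
have ma (S T : R) : 0 <= S -> measurable_fun `]S, T] a'.
  by move=> _; apply: measurable_funTS; exact: continuous_measurable_fun.
have gammak : gamma <= (2 * rb)^-1 * k%:R.
  rewrite mulrC ler_pdivlMr ?mulr_gt0//; apply: ltW; apply: archi_boundP.
  by rewrite mulr_ge0 ?(ltW gamma0)// mulr_ge0// ltW.
have a'_ge0 t : 0 <= t -> 0 <= a' t by move=> _; exact: ha0.
have a'_le t : 0 <= t -> a' t <= ab.
  by move=> _; apply: le_trans (ler_norm _) _; exact: hab.
have delta_le' t : Num.max t0 0 <= t -> delta <= \int[mu]_(s in `]t, t + gamma]) a' s.
  rewrite ge_max => /andP[t0t tge0].
  have ia : mu.-integrable `]t, t + gamma] (EFin \o a') by exact: continuous_itv_integrable.
  have ia' : mu.-integrable `[t, t + gamma] (EFin \o a').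
    apply: continuous_compact_integrable; first exact: segment_compact.
    exact: continuous_subspaceT.
  rewrite Rintegral_itv_obnd_cbnd// -lee_fin fineK; last first.
    by apply: integrable_fin_num ia'; exact: measurable_itv.
  apply: le_trans (delta_le t t0t) _; rewrite le_eqVlt; apply/orP; left; apply/eqP.
  apply: eq_integral => s; rewrite inE/= in_itv/= => /andP[ts _].
  by rewrite /ext max_l// (le_trans tge0).
have [t1 ht1] := logistic_inequality_bound m a' rb ab N rb0 m01 a'_ge0 a'_le mm ma m_le
  gamma delta (Num.max t0 0) k gamma0 delta0 gammak delta_le'.
exists (Num.max t1 0) => t; rewrite ge_max => /andP[t1t tge0].
pose A := [set w | N < X t w].
have mA : measurable A.
  rewrite (_ : A = setT `&` X t @^-1` `]N, +oo[); first exact: mX.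
  by apply/seteqP; split => w /=; rewrite in_itv/= andbT => //; case.
(* Back from the modification X to the given solution x. *)
have [|_ ->] := complete_measure_eq P hP A [set w | N < x t w] Z mA nZ.
  by apply/seteqP; split => w [/= h Zw]; split => //; move: h; rewrite /A /= XE.
have iV : P.-integrable setT (EFin \o (fun w => saturation N (X t w))).
  apply: (bounded_integrable P _ N) => //.
    apply: measurableT_comp => //; apply: continuous_measurable_fun.
    exact: continuous_saturation.
  by move=> w _; exact: saturation_le.
have PA : P A \is a fin_num by exact: fin_num_measure.
rewrite -(fineK PA) lee_fin ler_pdivlMr//.
have N20 : 0 < N / 2 by rewrite divr_gt0.
suff : N / 2 * fine (P A) <= K by move=> ?; lra.
apply: le_trans (ht1 t t1t).
have -> : N / 2 * fine (P A) = \int[P]_w (N / 2 * \1_A w).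
  rewrite RintegralZl//; last exact: integrable_indic.
  by rewrite /Rintegral integral_indic// setIT.
apply: le_Rintegral => //.
  by apply: integrable_EFinZ => //; exact: integrable_indic.
move=> w _; rewrite indicE; have [|] := boolP (w \in A).
  by rewrite inE => NX; rewrite mulr1 saturation_gt_half.
by rewrite mulr0 saturation_ge0// ltW.
Qed.

(** M = 2 K / eps makes the tail bound 2 K / M equal to eps. K is built from rb, gamma and delta
    alone, so M serves all solutions; only the time from which the bound holds is chosen for each
    solution. *)
Lemma logistic_ultimately_bounded :
  stochastically_ultimately_bounded P F B
    (fun t y => y * (r t - a t * y)) (fun t y => y * sigma t).
Proof.
move=> eps eps0 eps1.
have K0 : 0 < K.
  rewrite /K /logistic_bound divr_gt0// !mulr_gt0 ?exprn_gt0//.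
  by rewrite ltr_pwDl// !mulr_ge0 ?exprn_ge0// ltW.
have N0 : 0 < 2 * K / eps by rewrite divr_gt0// mulr_gt0.
exists (2 * K / eps) => // x solx.
have [t1 ht1] := solution_tail_bound x _ N0 solx.
apply: (limf_einf_pinfty_ge _ _ (Num.max t1 0)) => t; rewrite ge_max => /andP[t1t tge0].
have mx : measurable_fun setT (x t).
  by apply: (sub_measurable_fun F hF t) => //; case: solx => -[adx _ _ _ _] _ _; exact: adx.
have mA : measurable [set w | 2 * K / eps < x t w].
  rewrite (_ : [set _ | _] = setT `&` x t @^-1` `]2 * K / eps, +oo[); first exact: mx.
  by apply/seteqP; split => w /=; rewrite in_itv/= andbT => //; case.
rewrite (_ : [set _ | _] = ~` [set w | 2 * K / eps < x t w]); last first.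
  by apply/seteqP; split => w /=; rewrite leNgt => /negP.
rewrite probability_setC// EFinB leeB//.
apply: le_trans (ht1 t t1t) _; rewrite lee_fin.
by rewrite le_eqVlt; apply/orP; left; apply/eqP; field; rewrite !gt_eqF// ?mulr_gt0.
Qed.

End logistic_sde.

Theorem theorem3p2 (R : realType) (d : measure_display)
    (Omega : measurableType d) (P : probability Omega R)
    (hP : measure_is_complete P)
    (F : R -> set (set Omega)) (hF : filtration F)
    (hFu : usual_conditions P F)
    (B : R -> Omega -> R) (hB : brownian_motion P F B)
    (r a sigma : R -> R)
    (hrc : {within `[0, +oo[, continuous r})
    (hac : {within `[0, +oo[, continuous a})
    (hsc : {within `[0, +oo[, continuous sigma})
    (hrb : [bounded r t | t in `[0, +oo[])
    (hab : [bounded a t | t in `[0, +oo[])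
    (hsb : [bounded sigma t | t in `[0, +oo[])
    (ha0 : forall t : R, 0 <= t -> 0 <= a t)
    (hs0 : forall t : R, 0 <= t -> 0 <= sigma t)
    (gamma : R) (hgamma : 0 < gamma)
    (hliminf : (0 < limf_einf
       (fun t : R => \int[lebesgue_measure]_(s in `[t, (t + gamma)%R]) (a s)%:E)
       (pinfty_nbhs R))%E) :
  stochastically_ultimately_bounded P F B
    (fun t x => x * (r t - a t * x)) (fun t x => x * sigma t).
Proof.
have [rb rb0 rbE] := bounded_halfline r hrb.
have [ab _ abE] := bounded_halfline a hab.
have [sb _ sbE] := bounded_halfline sigma hsb.
have [t0 [delta [delta0 deltaE]]] := limf_einf_pinfty_gt0 _ hliminf.
exact: (logistic_ultimately_bounded P F hP hF hFu B hB r a sigma hrc hac hsc rb ab sb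
  rb0 rbE ha0 abE sbE gamma delta t0 hgamma delta0 deltaE).
Qed.
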